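(* Let $(\mathcal{A},\varphi)$ be a von Neumann algebra with a faithful, normal, tracial state and let $\mathcal{B}\subseteq\mathcal{A}$ be a von Neumann subalgebra. Let $X,Y\in\mathcal{A}$ be self-adjoint (bounded) random variables such that $X\in\mathcal{B}$ and $Y$ is free from $\mathcal{B}$, and let $f$ be a bounded complex-valued Borel function on the spectrum of $X$ with $f(X)\neq0$. Then there exists a unique function $\delta$ on $\mathbb{C}^+$ such that for every $z\in\mathbb{C}^+$ the element $z-X-\delta(z)f(X)f^*(X)$ is invertible and $$E_\varphi\bigl[(z-X-f(X)Yf^*(X))^{-1}\mid\mathcal{B}\bigr]=\bigl(z-X-\delta(z)f(X)f^*(X)\bigr)^{-1}.$$
   Context: $\mathbb{C}^+$ is the open upper half-plane. $f(X)$ is defined by Borel functional calculus and $f^*(X)=f(X)^*$. $Y$ free from $\mathcal{B}$ means that the unital algebra generated by $Y$ and $\mathcal{B}$ are freely independent with respect to $\varphi$. $E_\varphi[\,\cdot\mid\mathcal{B}]$ is the unique $\varphi$-preserving conditional expectation $\mathcal{A}\to\mathcal{B}$. *)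

(* Defs.v *)
From HB Require Import structures.
From mathcomp Require Import all_boot all_order all_algebra sesquilinear complex.
From mathcomp Require Import all_classical all_reals all_analysis.

Set Implicit Arguments.
Unset Strict Implicit.
Unset Printing Implicit Defensive.

Import Order.TTheory GRing.Theory Num.Theory.
Import numFieldNormedType.Exports.

Local Open Scope classical_set_scope.
Local Open Scope ring_scope.

Definition upper_half_plane (R : realType) := {z : R[i] | 0 < complex.Im z}.

Definition hilbert_dot (R : realType) (H : completeNormedModType R[i])
    (dot : {dot H for Num.conj}) : Prop :=
  forall x : H, `|x| ^+ 2 = dot x x.

Section Operators.
Context {R : realType} {H : completeNormedModType R[i]}.
Implicit Types (A B : set (H -> H)) (S T X : H -> H).

Definition bounded_operator : set (H -> H) := [set T | linear T /\ continuous T].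

Definition commutant A : set (H -> H) :=
  [set T | bounded_operator T /\ forall S, A S -> T \o S = S \o T].

Definition inverse_of T S : Prop := T \o S = id /\ S \o T = id.

(* The inverse of [T]; an arbitrary value if [T] is not bijective. *)
Definition op_inv T : H -> H := get [set S | inverse_of T S].

Definition invertible_in A T : Prop := exists2 S, A S & inverse_of T S.

Definition spectrum A X : set R[i] :=
  [set z | ~ invertible_in A (z *: (id : H -> H) - X)].

Definition unital_subalgebra A : Prop :=
  [/\ A id,
      forall (c : R[i]) S T, A S -> A T -> A (c *: S + T) &
      forall S T, A S -> A T -> A (S \o T)].

(* All members of [A i] are operators; [a 0 \o ... \o a n.-1] is the product
   [a_0 ... a_(n-1)] of the operator algebra. *)
Definition freely_independent (I : Type) (phi : (H -> H) -> R[i])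
    (A : I -> set (H -> H)) : Prop :=
  forall (n : nat) (i : nat -> I) (a : nat -> (H -> H)),
    (0 < n)%N ->
    (forall k, (k < n)%N -> A (i k) (a k) /\ phi (a k) = 0) ->
    (forall k, (k.+1 < n)%N -> i k <> i k.+1) ->
    phi (\big[comp/id]_(k < n) a k) = 0.

Definition free_from (phi : (H -> H) -> R[i]) (Y : H -> H) B : Prop :=
  freely_independent phi
    (fun b : bool => if b then smallest unital_subalgebra [set Y] else B).

Section InnerProduct.
Variable dot : {dot H for Num.conj}.

Definition is_adjoint T S : Prop := forall x y, dot (T x) y = dot x (S y).

Definition adjoint T : H -> H := get [set S | is_adjoint T S].

Definition self_adjoint T : Prop := is_adjoint T T.

(* For complex numbers [<=] compares numbers with a real difference. *)
Definition op_le S T : Prop := forall x, dot (S x) x <= dot (T x) x.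

(* The bicommutant equation makes [A] a unital algebra, closed in the weak
   operator topology. *)
Definition von_neumann_algebra A : Prop :=
  [/\ A `<=` bounded_operator,
      forall T, A T -> exists2 S, A S & is_adjoint T S &
      commutant (commutant A) = A].

Definition op_sup A (D : set (H -> H)) T : Prop :=
  [/\ A T,
      forall S, D S -> op_le S T &
      forall U, A U -> (forall S, D S -> op_le S U) -> op_le T U].

Record faithful_normal_tracial_state A (phi : (H -> H) -> R[i]) : Prop := {
  state_linear : forall (c : R[i]) S T, A S -> A T ->
    phi (c *: S + T) = c * phi S + phi T;
  state_unit : phi id = 1;
  state_positive : forall T, A T -> op_le 0 T -> 0 <= phi T;
  state_faithful : forall T, A T -> phi (adjoint T \o T) = 0 -> T = 0;
  state_normal : forall (D : set (H -> H)) T,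
    D !=set0 -> D `<=` A -> (forall S, D S -> self_adjoint S) ->
    (forall S1 S2, D S1 -> D S2 ->
       exists S3, [/\ D S3, op_le S1 S3 & op_le S2 S3]) ->
    op_sup A D T -> supremums (phi @` D) (phi T);
  state_tracial : forall S T, A S -> A T -> phi (S \o T) = phi (T \o S) }.

(* These properties determine [E] on [A]. *)
Record conditional_expectation A B (phi : (H -> H) -> R[i])
    (E : (H -> H) -> (H -> H)) : Prop := {
  condexp_range : forall T, A T -> B (E T);
  condexp_linear : forall (c : R[i]) S T, A S -> A T ->
    E (c *: S + T) = c *: E S + E T;
  condexp_positive : forall T, A T -> op_le 0 T -> op_le 0 (E T);
  condexp_id : forall T, B T -> E T = T;
  condexp_bimodule : forall S T U, B S -> A T -> B U ->
    E (S \o T \o U) = S \o E T \o U;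
  condexp_state : forall T, A T -> phi (E T) = phi T }.

Definition bounded_borel_on (D : set R[i]) (f : R[i] -> R[i]) : Prop :=
  (exists M : R[i], forall t, D t -> `|f t| <= M) /\
  (forall U : set R[i]^o, open U -> <<s @open R[i]^o >> (D `&` f @^-1` U)).

(* The Borel functional calculus of [X], with [Phi f] in the role of [f(X)]:
   the unique unital *-homomorphism on the bounded Borel functions on the
   spectrum which sends the identity function to [X] and bounded pointwise
   convergence to strong convergence.  A function on the spectrum is represented
   by any extension of it to the complex plane; by [fc_cvg], [Phi f] does not
   depend on the extension. *)
Record borel_functional_calculus A X (Phi : (R[i] -> R[i]) -> (H -> H)) :
    Prop := {
  fc_bounded : forall f, bounded_borel_on (spectrum A X) f ->
    bounded_operator (Phi f);
  fc_one : Phi (cst 1) = id;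
  fc_id : Phi id = X;
  fc_linear : forall (c : R[i]) f g,
    bounded_borel_on (spectrum A X) f -> bounded_borel_on (spectrum A X) g ->
    Phi (fun t => c * f t + g t) = c *: Phi f + Phi g;
  fc_mul : forall f g,
    bounded_borel_on (spectrum A X) f -> bounded_borel_on (spectrum A X) g ->
    Phi (fun t => f t * g t) = Phi f \o Phi g;
  fc_adjoint : forall f, bounded_borel_on (spectrum A X) f ->
    is_adjoint (Phi f) (Phi (fun t => Num.conj (f t)));
  fc_cvg : forall (fn : nat -> R[i] -> R[i]) f (M : R[i]),
    (forall n, bounded_borel_on (spectrum A X) (fn n)) ->
    bounded_borel_on (spectrum A X) f ->
    (forall n t, spectrum A X t -> `|fn n t| <= M) ->
    (forall t, spectrum A X t -> (fn n t : R[i]^o) @[n --> \oo] --> (f t : R[i]^o)) ->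
    forall x : H, Phi (fn n) x @[n --> \oo] --> Phi f x }.

End InnerProduct.
End Operators.

(* Main.v *)
Require Import Defs.
From HB Require Import structures.
From mathcomp Require Import all_boot all_order all_algebra sesquilinear complex.
From mathcomp Require Import all_classical all_reals all_analysis.
From mathcomp Require Import ring lra.

Set Implicit Arguments.
Unset Strict Implicit.
Unset Printing Implicit Defensive.

Import Order.TTheory GRing.Theory Num.Theory.
Import numFieldNormedType.Exports.

Local Open Scope classical_set_scope.
Local Open Scope ring_scope.

(* Put [F = f(X)], [F' = F^*], [S = X + F Y F'] and [N = (z - S)^-1].
   Freeness of [Y] from [B] says that [phi (x) phi] vanishes on the range of
   the derivation [d] of the algebra generated by [B] and [Y] with [d b = 0]
   for [b] in [B] and [d Y = Y (x) 1 - 1 (x) Y].  As [N] is a norm limit of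
   polynomials in [S] whose derivatives [d] converge too, this applies to
   [a N b] with [a] and [b] in [B]:
     phi(a N F Y) phi(F' N b) = phi(a N F) phi(Y F' N b).
   Faithfulness of [phi] gives [Im phi(F' N F) < 0], so that with the scalar
   [delta = phi(Y F' N F) / phi(F' N F)] we get [E[N F Y] = delta E[N] F].
   Applying [E] to [N (z - X) = 1 + N F Y F'] yields
   [E[N] (z - X - delta F F') = 1], and symmetrically on the other side.
   That [F] lies in [B] follows from the bicommutant equation: an operator that
   commutes with [X] commutes with the polynomials in [X], hence with the
   spectral projections of half-lines, which are strong limits of polynomials,
   hence with all spectral projections and bounded Borel functions of [X]. *)

(** No tensor product is formed, and whether the derivation is well defined on the generated
    algebra, where one element has many expressions as words, is never asked: an element travels
    together with the functional that its derivative induces, and freeness is shown to annihilate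
    every pair built by Leibniz' rule. Expanding [N] in powers of [S / z] would only work for large
    [z] and require analytic continuation. Instead, [S] being self-adjoint, the product of
    [conj z - S] and [z - S] lies between [(Im z)^2] and some [m^2], so that
    [e = 1 - k (conj z - S) (z - S)] with [k = m^-2] is a strict contraction for every [z] in the
    half-plane, and [N - e^n N] is a polynomial in [S]. The derivative of [e^n] has a number of
    terms proportional to [n], so errors have the form [(C0 + n C1) q^n] instead of a plain
    geometric bound. For the half-lines, the sign function is reached by iterating one cubic
    polynomial, which keeps the approximation explicit. *)

Section LinearMaps.
Variables (K : nzRingType) (U V : lmodType K).

Lemma lin0 (T : U -> V) : linear T -> T 0 = 0.
Proof.
by move=> l; have := l (-1) 0 0; rewrite scaler0 addr0 scaleN1r addNr.
Qed.

Lemma linD (T : U -> V) : linear T -> {morph T : x y / x + y}.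
Proof. by move=> l x y; have := l 1 x y; rewrite !scale1r. Qed.

Lemma linZ (T : U -> V) : linear T -> forall c, {morph T : x / c *: x}.
Proof. by move=> l c x; have := l c x 0; rewrite (lin0 l) !addr0. Qed.

Lemma linB (T : U -> V) : linear T -> {morph T : x y / x - y}.
Proof. by move=> l x y; rewrite (linD l) -scaleN1r (linZ l) scaleN1r. Qed.

Lemma scalar_mapD (g : U -> K) : scalar g -> {morph g : x y / x + y}.
Proof. by move=> l x y; have := l 1 x y; rewrite scale1r mul1r. Qed.

Lemma scalar_mapZ (g : U -> K) : scalar g -> forall c x, g (c *: x) = c * g x.
Proof.
move=> l c x; have g0 : g 0 = 0.
  by have := l (-1) 0 0; rewrite scaler0 addr0 mulN1r addNr.
by have := l c x 0; rewrite g0 !addr0.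
Qed.

Lemma scalar_mapB (g : U -> K) : scalar g -> {morph g : x y / x - y}.
Proof.
by move=> l x y; rewrite (scalar_mapD l) -scaleN1r (scalar_mapZ l) mulN1r.
Qed.

End LinearMaps.

(** * Freeness and derivations *)

Section FreeDerivation.
Variables (K : numFieldType) (L : algType K) (phi : L -> K).
Hypotheses (phi_linear : scalar phi) (phi1 : phi 1 = 1).
Variable alg : bool -> set L.

Let phiD := scalar_mapD phi_linear.
Let phiZ := scalar_mapZ phi_linear.

Definition subalgebra (S : set L) :=
  [/\ S 1, forall c a b, S a -> S b -> S (c *: a + b) &
      forall a b, S a -> S b -> S (a * b)].

Definition letters (l : seq (bool * L)) := forall x, x \in l -> alg x.1 x.2.
Definition centered (l : seq (bool * L)) := forall x, x \in l -> phi x.2 = 0.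
Definition alternating (l : seq (bool * L)) :=
  sorted (fun x y => x.1 != y.1) l.
Definition word (l : seq (bool * L)) : L := \prod_(x <- l) x.2.

Hypothesis alg_sub : forall i, subalgebra (alg i).
Hypothesis alg_free : forall l, l != [::] -> letters l -> centered l ->
  alternating l -> phi (word l) = 0.

(* The pair [(v, zeta)] stands for an element [v] with a derivative [d v] in
   [L (x) L], known through [zeta p = (phi (x) phi) ((p (x) 1) * d v)].  The
   derivation is [0] on [alg false] and [a |-> a (x) 1 - 1 (x) a] on
   [alg true]; [act (i, a)] is left multiplication by [a], by Leibniz' rule. *)
Definition act (x : bool * L) (P : L * (L -> K)) : L * (L -> K) :=
  (x.2 * P.1,
   fun p => (if x.1 then phi (p * x.2) * phi P.1 - phi p * phi (x.2 * P.1)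
             else 0) + P.2 (p * x.2)).

Definition pair_comb (c : K) (P Q : L * (L -> K)) : L * (L -> K) :=
  (c *: P.1 + Q.1, fun p => c * P.2 p + Q.2 p).

Definition acts (l : seq (bool * L)) P := foldr act P l.
Definition unit_pair : L * (L -> K) := (1, fun=> 0).

Lemma pair_eq (P Q : L * (L -> K)) : P.1 = Q.1 -> P.2 =1 Q.2 -> P = Q.
Proof. by case: P Q => [a f] [b g] /= -> /funext ->. Qed.

Lemma act_comb x c P Q :
  act x (pair_comb c P Q) = pair_comb c (act x P) (act x Q).
Proof.
apply: pair_eq => [|p] /=; first by rewrite mulrDr scalerAr.
case: x.1; last by rewrite !add0r.
rewrite mulrDr -scalerAr !phiD !phiZ /=; ring.
Qed.

Lemma acts_comb l c P Q :
  acts l (pair_comb c P Q) = pair_comb c (acts l P) (acts l Q).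
Proof. by elim: l => //= x l ->; rewrite act_comb. Qed.

Lemma act_scalar x P : scalar P.2 -> scalar (act x P).2.
Proof.
move=> Plin c a b /=; rewrite mulrDl -scalerAl Plin.
by case: x.1; rewrite ?add0r// !phiD !phiZ /=; ring.
Qed.

Lemma acts_scalar l P : scalar P.2 -> scalar (acts l P).2.
Proof. by elim: l => //= x l IH /IH; exact: act_scalar. Qed.

Lemma unit_pair_scalar : scalar unit_pair.2.
Proof. by move=> c a b /=; rewrite mulr0 addr0. Qed.

(** The derivation vanishes on scalars, so the scalar part of a letter merely deletes that letter
    from the word. *)
Lemma act_scalarD i c a P : scalar P.2 ->
  act (i, c *: 1 + a) P = pair_comb c P (act (i, a) P).
Proof.
move=> Plin; apply: pair_eq => [|p] /=; first by rewrite mulrDl -scalerAl mul1r.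
rewrite mulrDr -scalerAr mulr1 mulrDl -scalerAl mul1r Plin.
by case: i; rewrite ?add0r// !phiD !phiZ /=; ring.
Qed.

(** For [i = true] the two terms [phi (p * a) * phi (b * P.1)] cancel: this is Leibniz' rule for the
    inner derivation, read through the functionals. *)
Lemma act_merge i a b P : act (i, a) (act (i, b) P) = act (i, a * b) P.
Proof.
apply: pair_eq => [|p] /=; first by rewrite mulrA.
by case: i; rewrite ?add0r !mulrA// addrA; congr (_ + _); ring.
Qed.

Lemma acts_cat l1 l2 P : acts (l1 ++ l2) P = acts l1 (acts l2 P).
Proof. exact: foldr_cat. Qed.

Lemma acts_fst l : (acts l unit_pair).1 = word l.
Proof. by rewrite /word; elim: l => [|x l IH] /=;
  rewrite ?big_nil// big_cons IH. Qed.

(** Each term of the derivative cuts the word just before or just after a letter. The half that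
    receives this letter is a nonempty alternating centered word, on which [phi] vanishes by
    freeness. *)
Lemma centered_derivation l1 l2 :
  letters (l1 ++ l2) -> centered (l1 ++ l2) -> alternating (l1 ++ l2) ->
  (acts l2 unit_pair).2 (word l1) = 0.
Proof.
elim: l2 l1 => // x l2 IH l1 hl hc ha /=.
have wr : word l1 * x.2 = word (rcons l1 x) by rewrite /word big_rcons.
rewrite acts_fst wr IH ?cat_rcons// addr0.
case: ifP => // _.
have -> : phi (word (rcons l1 x)) = 0.
  apply: alg_free => [|y yl|y yl|]; first by case: (l1).
  - by apply: hl; rewrite -cat_rcons mem_cat yl.
  - by apply: hc; rewrite -cat_rcons mem_cat yl.
  - by move: ha; rewrite -cat_rcons => /cat_sorted2 [].
have -> : x.2 * word l2 = word (x :: l2) by rewrite /word big_cons.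
have -> : phi (word (x :: l2)) = 0.
  apply: alg_free => // [y yl|y yl|].
  - by apply: hl; rewrite mem_cat yl orbT.
  - by apply: hc; rewrite mem_cat yl orbT.
  - by move: ha => /cat_sorted2 [].
by rewrite mul0r mulr0 subrr.
Qed.

Lemma not_alternating l : ~~ alternating l ->
  exists l1 i a b l2, l = l1 ++ (i, a) :: (i, b) :: l2.
Proof.
elim: l => // -[i a] [//|[j b] l] IH /=; rewrite negb_and negbK.
case/orP=> [/eqP ->|/IH [l1 [k [c [d [l2 ->]]]]]].
  by exists [::], j, a, b, l.
by exists ((i, a) :: l1), k, c, d, l2.
Qed.

(** Induction on the length over all words, alternating or not: neighbours from the same algebra
    merge into a shorter word, and centering a letter of an alternating word produces a shorter
    word, which may fail to alternate, and a word with one more centered letter. *)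
Lemma words_derivation l : letters l -> (acts l unit_pair).2 1 = 0.
Proof.
have [n] := ubnP (size l); elim: n l => // n IH l /ltnSE sl hl.
have [alt|/not_alternating [l1 [i [a [b [l2 El]]]]]] := boolP (alternating l);
  last first.
  rewrite El acts_cat /= act_merge -[X in acts l1 X]/(acts ((i,
    a * b) :: l2) _).
  rewrite -acts_cat; apply: IH.
    by move: sl; rewrite El !size_cat /= !addnS.
  have hla : alg i a by apply: (hl (i, a)); rewrite El mem_cat inE eqxx orbT.
  have hlb : alg i b.
    by apply: (hl (i, b)); rewrite El mem_cat !inE eqxx !orbT.
  move=> x; rewrite mem_cat inE => /or3P[xl|/eqP ->|xl].
  - by apply: hl; rewrite El mem_cat xl.
  - by have [_ _] := alg_sub i; apply.
  - by apply: hl; rewrite El mem_cat !inE xl !orbT.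
(* The letters are centered from left to right; [l1] is the prefix already treated. *)
suff H l1 l2 : size (l1 ++ l2) = size l -> letters (l1 ++ l2) ->
    alternating (l1 ++ l2) -> centered l1 -> (acts (l1 ++ l2) unit_pair).2 1 =
      0.
  by apply: (H [::] l).
elim: l2 l1 => [|[i a] l2 IH2] l1 sl12 hl12 alt12 c1.
  rewrite cats0; have := @centered_derivation [::] l1.
  by rewrite /= cats0 in hl12 alt12 *; rewrite /word big_nil; apply.
pose a0 := (- phi a) *: 1 + a.
have phi_a0 : phi a0 = 0 by rewrite phiD phiZ phi1 mulr1 addNr.
have hla : alg i a by apply: (hl12 (i, a)); rewrite mem_cat inE eqxx orbT.
have hla0 : alg i a0 by have [one lin _] := alg_sub i; exact: lin.
have Ea : a = phi a *: 1 + a0 by rewrite /a0 scaleNr addrA subrr add0r.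
have P2 : scalar (acts l2 unit_pair).2 by exact/acts_scalar/unit_pair_scalar.
rewrite acts_cat /= {1}Ea act_scalarD// acts_comb /=.
rewrite -acts_cat IH ?mulr0 ?add0r.
- rewrite -[act _ _]/(acts ((i, a0) :: l2) unit_pair) -acts_cat -cat_rcons.
  apply: IH2.
  + by rewrite cat_rcons -sl12 !size_cat.
  + move=> x; rewrite mem_cat mem_rcons inE -orbA => /or3P[/eqP ->//|xl|xl].
      by apply: hl12; rewrite mem_cat xl.
    by apply: hl12; rewrite mem_cat inE xl !orbT.
  + move: alt12; rewrite /alternating cat_rcons; clear.
    by case: l1 => [|x l1] /=; [case: l2|rewrite !cat_path /=; case: l2].
  + by move=> x; rewrite mem_rcons inE => /orP[/eqP ->//|/c1].
- by rewrite (leq_trans _ sl)// -sl12 !size_cat ltn_add2l.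
- move=> x xl; apply: hl12; move: xl; rewrite !mem_cat inE.
  by case/orP => ->; rewrite ?orbT.
Qed.

(** Quantifying over all words to the left makes the property stable under multiplication by
    letters. *)
Definition good P := forall l, letters l -> (acts l P).2 1 = 0.

Lemma good_unit : good unit_pair.
Proof. exact: words_derivation. Qed.

Lemma good_comb c P Q : good P -> good Q -> good (pair_comb c P Q).
Proof.
by move=> gP gQ l hl; rewrite acts_comb /= gP// gQ// mulr0 addr0.
Qed.

Lemma good_act i a P : alg i a -> good P -> good (act (i, a) P).
Proof.
move=> ha gP l hl; rewrite -[X in acts l X]/(acts [:: (i, a)] P) -acts_cat.
apply: gP => x; rewrite mem_cat inE => /orP[/hl//|/eqP ->//].
Qed.

(** As the derivation is zero on [alg false], the one-letter word [b] does nothing but move the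
    evaluation point from [1] to [b]. *)
Lemma good_at b P : alg false b -> good P -> P.2 b = 0.
Proof.
move=> hb /(_ [:: (false, b)]) /=; rewrite add0r mul1r; apply => x.
by rewrite inE => /eqP ->.
Qed.

(** * The derivation at the resolvent *)

Variables (X Y F F' : L).
Hypotheses (algX : alg false X) (algY : alg true Y) (algF : alg false F).
Hypothesis algF' : alg false F'.
Let s := X + F * Y * F'.

(* [(phi (x) phi) ((p (x) 1) * d s * (1 (x) v))] *)
Definition theta p v :=
  phi (p * F * Y) * phi (F' * v) - phi (p * F) * phi (Y * F' * v).

(** Left multiplication by [a - s] under Leibniz' rule; the sign of [theta] comes from
    [d (a - s) = - d s]. *)
Definition shift (a : K) (P : L * (L -> K)) : L * (L -> K) :=
  ((a%:A - s) * P.1, fun p => P.2 (p * (a%:A - s)) - theta p P.1).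

Definition zero_pair : L * (L -> K) := (0, fun=> 0).

Lemma good_zero : good zero_pair.
Proof.
move=> l hl; have -> : zero_pair = pair_comb (-1) unit_pair unit_pair.
  by apply: pair_eq => [|p] /=; rewrite ?scaleN1r ?addNr// mulr0 addr0.
by apply: good_comb hl; exact: good_unit.
Qed.

Lemma comb_scalar c P Q : scalar P.2 -> scalar Q.2 -> scalar (pair_comb c P
  Q).2.
Proof. by move=> Pl Ql k a b /=; rewrite Pl Ql; ring. Qed.

Lemma shiftE a P : scalar P.2 ->
  shift a P = pair_comb a P (pair_comb (-1) (act (false, X) P)
    (pair_comb (-1) (act (false, F) (act (true, Y) (act (false, F') P)))
       zero_pair)).
Proof.
move=> Plin.
apply: pair_eq => [|p] /=.
  by rewrite mulrBl mulrDl -scalerAl mul1r opprD !scaleN1r addr0 !mulrA.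
rewrite mulrBr mulrDr -scalerAr mulr1 !mulrA.
rewrite (scalar_mapB Plin) (scalar_mapD Plin) (scalar_mapZ Plin) !add0r /theta.
by ring.
Qed.

Lemma shift_scalar a P : scalar P.2 -> scalar (shift a P).2.
Proof.
move=> Plin c u v; rewrite /= /theta !mulrDl -!scalerAl Plin !phiD !phiZ /=.
ring.
Qed.

Lemma good_shift a P : scalar P.2 -> good P -> good (shift a P).
Proof.
move=> Plin gP; rewrite shiftE//; do !apply: good_comb => //.
- exact: good_act.
- by do 3!apply: good_act => //.
- exact: good_zero.
Qed.

Lemma shift_comb a c P Q :
  shift a (pair_comb c P Q) = pair_comb c (shift a P) (shift a Q).
Proof.
apply: pair_eq => [|p] /=; first by rewrite mulrDr scalerAr.
rewrite /theta !mulrDr -!scalerAr !phiD !phiZ /=; ring.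
Qed.

Variables (z w k : K) (r : L).
Hypothesis zr : (z%:A - s) * r = 1.

Let e := 1 - k *: ((w%:A - s) * (z%:A - s)).

Definition step P := pair_comb (- k) (shift w (shift z P)) P.

Lemma step_scalar P : scalar P.2 -> scalar (step P).2.
Proof. by move=> Plin; apply: comb_scalar => //; do 2!apply: shift_scalar. Qed.

Lemma stepE P : scalar P.2 -> step P = (e * P.1, fun p => P.2 (p * e) +
  k * (theta (p * (w%:A - s)) P.1 + theta p ((z%:A - s) * P.1))).
Proof.
move=> Plin.
apply: pair_eq => [|p].
  by rewrite /= /e [RHS]mulrBl mul1r -scalerAl mulrA scaleNr addrC.
rewrite /step /shift /=.
have -> : p * e = p - k *: (p * (w%:A - s) * (z%:A - s)).
  by rewrite /e mulrBr mulr1 -scalerAr mulrA.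
rewrite (scalar_mapB Plin) (scalar_mapZ Plin); ring.
Qed.

Variable b : L.
Hypothesis algb : alg false b.

(** Leibniz' rule forces [d r = r (d s) r] on an inverse [r] of [z - s]. Since [r] need not be a
    polynomial in the letters, this pair is not good by construction. *)
Definition fixed_pair : L * (L -> K) := (r * b, fun p => theta (p * r) (r * b)).

Lemma fixed_pair_scalar : scalar fixed_pair.2.
Proof.
by move=> c u v; rewrite /= /theta !mulrDl -!scalerAl !phiD !phiZ /=; ring.
Qed.

Lemma shift_fixed_pair : shift z fixed_pair = act (false, b) unit_pair.
Proof.
apply: pair_eq => [|p] /=; first by rewrite mulrA zr mul1r mulr1.
by rewrite -mulrA zr mulr1 subrr addr0.
Qed.

Lemma iter_step_scalar n : scalar (iter n step fixed_pair).2.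
Proof.
elim: n => [|n IH]; first exact: fixed_pair_scalar.
by rewrite iterS; exact: step_scalar.
Qed.

(* [shift z fixed_pair] is the pair of [b], which is good; hence if
   [fixed_pair - P] is good, so is [fixed_pair - step P]. *)
Lemma good_iter_step n :
  good (pair_comb (-1) (iter n step fixed_pair) fixed_pair).
Proof.
elim: n => [|n IH].
  have -> : pair_comb (-1) (iter 0 step fixed_pair) fixed_pair = zero_pair.
    by apply: pair_eq => [|p] /=; rewrite ?scaleN1r ?addNr// mulN1r addNr.
  exact: good_zero.
set D := iter n step fixed_pair in IH *.
have Dl : scalar D.2 by exact: iter_step_scalar.
have DE : shift z D = pair_comb (-1) (shift z (pair_comb (-1) D fixed_pair))
    (act (false, b) unit_pair).
  rewrite shift_comb -shift_fixed_pair; apply: pair_eq => [|p] /=.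
    by rewrite scalerDr scalerA mulN1r opprK scale1r scaleN1r subrK.
  by ring.
have -> : pair_comb (-1) (iter n.+1 step fixed_pair) fixed_pair =
   pair_comb k (shift w (shift z D)) (pair_comb (-1) D fixed_pair).
  rewrite iterS -/D /step; apply: pair_eq => [|p] /=; last by ring.
  by rewrite scalerDr scalerA mulN1r opprK addrA.
have fl := fixed_pair_scalar.
have bl : scalar (act (false, b) unit_pair).2.
  by apply: act_scalar; exact: unit_pair_scalar.
apply: good_comb (IH); apply: good_shift; first exact: shift_scalar.
rewrite DE; apply: good_comb; last exact/good_act/good_unit.
by apply: good_shift => //; exact: comb_scalar.
Qed.

Variable q : K.
Hypothesis q_gt0 : 0 < q.
(** The analytic input of this algebraic part: for operators it follows from the bound [q] on the
    norm of [e]. *)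
Hypothesis e_decay : forall u v, exists2 C : K, 0 <= C &
  forall n, `|phi (u * e ^+ n * v)| <= C * q ^+ n.

Lemma theta_decay p u t v : exists2 C : K, 0 <= C & forall i j,
  `|theta (p * e ^+ i * u) (t * e ^+ j * v)| <= C * q ^+ (i + j).
Proof.
have [C1 C1p H1] := e_decay p (u * F * Y).
have [C2 C2p H2] := e_decay (F' * t) v.
have [C3 C3p H3] := e_decay p (u * F).
have [C4 C4p H4] := e_decay (Y * F' * t) v.
exists (C1 * C2 + C3 * C4) => [|i j]; first by rewrite addr_ge0 ?mulr_ge0.
have -> : (C1 * C2 + C3 * C4) * q ^+ (i + j) = C1 * q ^+ i * (C2 * q ^+ j) +
  C3 * q ^+ i * (C4 * q ^+ j) by rewrite exprD; ring.
rewrite /theta (le_trans (ler_normB _ _))// !normrM lerD// ler_pM//.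
- by move: (H1 i); rewrite !mulrA.
- by move: (H2 j); rewrite !mulrA.
- by move: (H3 i); rewrite !mulrA.
- by move: (H4 j); rewrite !mulrA.
Qed.

Lemma iter_step_fst n : (iter n step fixed_pair).1 = e ^+ n * (r * b).
Proof.
elim: n => [|n IH]; first by rewrite expr0 mul1r.
by rewrite iterS stepE ?IH ?exprS ?mulrA//; exact: iter_step_scalar.
Qed.

(** Every step contributes terms [theta] whose arguments contain powers of [e] of total exponent one
    less than the new one; [n] steps give the factor linear in [n], and the lost exponent is the
    division by [q] in [C]. *)
Lemma iter_step_decay p : exists C0 C1 : K, forall n,
  `|(iter n step fixed_pair).2 p| <= (C0 + n%:R * C1) * q ^+ n.
Proof.
have [C0 C0p H0] := theta_decay p r 1 (r * b).
have [C1 C1p H1] := theta_decay p (w%:A - s) 1 (r * b).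
have [C2 C2p H2] := theta_decay p 1 (z%:A - s) (r * b).
pose C := `|k| * (C1 + C2) / q.
(* By [stepE] a step moves one factor [e] into the argument of the functional, so the induction
   needs the estimate at all [p * e ^+ j]. *)
suff H n j : `|(iter n step fixed_pair).2 (p * e ^+ j)| <=
    (C0 + n%:R * C) * q ^+ (n + j).
  by exists C0, C => n; have := H n 0; rewrite expr0 mulr1 addn0.
elim: n j => [|n IH] j.
  rewrite mul0r addr0 add0n; have := H0 j 0.
  by rewrite expr0 mul1r mul1r addn0; apply.
rewrite iterS stepE/=; last exact: iter_step_scalar.
rewrite iter_step_fst -[p * _ * e]mulrA -exprSr.
have -> : (C0 + n.+1%:R * C) * q ^+ (n.+1 + j) =
  (C0 + n%:R * C) * q ^+ (n + j.+1) + `|k| * (C1 + C2) * q ^+ (n + j).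
  rewrite addSnnS addnS exprS /C -[n.+1%:R]natr1; field.
  by rewrite gt_eqF.
rewrite (le_trans (ler_normD _ _))// lerD// normrM -mulrA ler_wpM2l//.
rewrite (le_trans (ler_normD _ _))// [(C1 + C2) * _]mulrDl lerD//.
  by have := H1 j n; rewrite mul1r addnC; apply.
by have := H2 j n; rewrite mulr1 !mulrA addnC; apply.
Qed.

(** The left side does not depend on [n]: the difference of [fixed_pair] and its iterate is good, so
    both functionals agree at [a], and the iterate decays. *)
Lemma free_resolvent_decay a : alg false a -> exists C0 C1 : K, forall n,
  `|theta (a * r) (r * b)| <= (C0 + n%:R * C1) * q ^+ n.
Proof.
move=> ha; have [C0 [C1 H]] := iter_step_decay a.
exists C0, C1 => n; rewrite (le_trans _ (H n))//.
have := good_at ha (good_iter_step n).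
by rewrite /= mulN1r => /eqP; rewrite addrC subr_eq0 => /eqP ->.
Qed.

End FreeDerivation.

(** * The conditional expectation of the resolvent, algebraically *)

Section Subordination.
Variables (K : numFieldType) (L : algType K) (phi : L -> K).
Hypothesis phi_linear : scalar phi.
Variables (B : set L) (E : L -> L).
Hypotheses (subB : subalgebra B) (EB : forall x, B (E x)) (E1 : E 1 = 1).
Hypothesis E_linear : linear E.
Hypothesis E_bimodule : forall a x b, B a -> B b -> E (a * x * b) = a * E x * b.
Hypothesis phiE : forall x, phi (E x) = phi x.
Hypothesis faithful_l : forall u, B u -> (forall a,
  B a -> phi (a * u) = 0) -> u = 0.
Hypothesis faithful_r : forall u, B u -> (forall b,
  B b -> phi (u * b) = 0) -> u = 0.

Let phiZ := scalar_mapZ phi_linear.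
Let phiB := scalar_mapB phi_linear.

Variables (X Y F F' r : L) (z : K).
Hypotheses (BX : B X) (BF : B F) (BF' : B F').
Let s := X + F * Y * F'.
Hypotheses (rz : r * (z%:A - s) = 1) (zr : (z%:A - s) * r = 1).
Hypothesis theta0 : forall a b,
  B a -> B b -> theta phi Y F F' (a * r) (r * b) = 0.
Hypothesis nz : phi (F' * r * F) != 0.

Definition subordination : K := phi (Y * F' * r * F) / phi (F' * r * F).
Let c := subordination.
Let D := z%:A - X - c *: (F * F').

Lemma condexp_mull a x : B a -> E (a * x) = a * E x.
Proof. by move=> Ba; have [B1 _ _] := subB;
  rewrite -[a * x]mulr1 E_bimodule// mulr1. Qed.

Lemma condexp_mulr x b : B b -> E (x * b) = E x * b.
Proof. by move=> Bb; have [B1 _ _] := subB;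
  rewrite -[x]mul1r E_bimodule// !mul1r. Qed.

(** Taking [b = F] in [theta0] produces the factor [phi (F' * r * F)], which [nz] cancels. *)
Lemma phi_theta_l a : B a -> phi (a * r * F * Y) = c * phi (a * r * F).
Proof.
move=> Ba; have := theta0 Ba BF; rewrite /theta !mulrA => /eqP.
rewrite subr_eq0 => /eqP H; apply: (mulIf nz); rewrite H /c /subordination.
by field.
Qed.

(** Taking [a = F'] in [theta0]; the left identity at [F'] shows that the constant is the same [c]
    on both sides. *)
Lemma phi_theta_r b : B b -> phi (Y * F' * r * b) = c * phi (F' * r * b).
Proof.
move=> Bb; have := theta0 BF' Bb; rewrite /theta !mulrA => /eqP.
rewrite subr_eq0 phi_theta_l// => /eqP H; apply: (mulfI nz); rewrite -H; ring.
Qed.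

Lemma condexp_resolvent_l : E (r * F * Y) = c *: (E r * F).
Proof.
have [B1 Blin Bmul] := subB.
apply/eqP; rewrite -subr_eq0; apply/eqP; apply: faithful_l.
  by rewrite addrC -scaleNr; apply: Blin => //; exact: Bmul.
move=> a Ba; rewrite mulrBr -scalerAr phiB phiZ mulrA.
rewrite -!condexp_mull// -condexp_mulr// !phiE !mulrA phi_theta_l//.
exact: subrr.
Qed.

Lemma condexp_resolvent_r : E (Y * F' * r) = c *: (F' * E r).
Proof.
have [B1 Blin Bmul] := subB.
apply/eqP; rewrite -subr_eq0; apply/eqP; apply: faithful_r.
  by rewrite addrC -scaleNr; apply: Blin => //; exact: Bmul.
move=> b Bb; rewrite mulrBl -scalerAl phiB phiZ.
rewrite -condexp_mull// -!condexp_mulr// !phiE phi_theta_r//.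
exact: subrr.
Qed.

Lemma B_shift : B (z%:A - X).
Proof.
have [B1 Blin _] := subB.
have B0 : B 0 by rewrite -(addNr 1) -scaleN1r; exact: Blin.
by apply: (Blin) => //; rewrite -scaleN1r -[_ *: X]addr0; exact: Blin.
Qed.

Lemma condexp_resolvent_mull : E r * D = 1.
Proof.
have H : r * (z%:A - X) = 1 + r * F * Y * F'.
  have -> : z%:A - X = (z%:A - s) + F * Y * F' by rewrite /s opprD addrA subrK.
  by rewrite mulrDr rz !mulrA.
have := congr1 E H; rewrite (linD E_linear) E1 (condexp_mulr _ B_shift).
rewrite condexp_mulr// condexp_resolvent_l => H2.
by rewrite /D mulrBr H2 -scalerAl -scalerAr mulrA addrK.
Qed.

Lemma condexp_resolvent_mulr : D * E r = 1.
Proof.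
have H : (z%:A - X) * r = 1 + F * (Y * F' * r).
  have -> : z%:A - X = (z%:A - s) + F * Y * F' by rewrite /s opprD addrA subrK.
  by rewrite mulrDl zr !mulrA.
have := congr1 E H; rewrite (linD E_linear) E1 (condexp_mull _ B_shift).
rewrite condexp_mull// condexp_resolvent_r => H2.
by rewrite /D mulrBl H2 -scalerAl -scalerAr mulrA addrK.
Qed.

End Subordination.

(** * Operators on a Hilbert space *)

Lemma cvg_exprn_complex (R : realType) (q : R[i]) : 0 <= q -> q < 1 ->
  forall eps : R[i], 0 < eps -> exists n, forall m, (n <= m)%N -> q ^+ m < eps.
Proof.
move=> q0 q1 eps eps0.
have E (x : R[i]) : 0 <= x -> x = (complex.Re x)%:C%C by move=>
  /ger0_real/RRe_real.
have q0' : 0 <= complex.Re q by move: q0; rewrite lecE => /andP[].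
have q1' : complex.Re q < 1 by move: q1; rewrite ltcE => /andP[].
have eps0' : 0 < complex.Re eps by move: eps0; rewrite ltcE => /andP[].
have /cvgrPdist_lt/(_ _ eps0')[N _ HN] : (GRing.exp (complex.Re q) : R^nat) n
  @[n --> \oo] --> 0.
  by apply: cvg_expr; rewrite ger0_norm.
exists N => m /HN; rewrite sub0r normrN ger0_norm ?exprn_ge0// => lt_eps.
by rewrite (E q q0) (E eps (ltW eps0)) -rmorphXn /= ltcR.
Qed.

(** At the exponent [2 m], one factor [q ^+ m] absorbs the linear growth and the other still tends
    to zero. *)
Lemma linear_geometric_eq0 (R : realType) (x q C0 C1 : R[i]) :
  0 <= x -> 0 < q -> q < 1 ->
  (forall n, x <= (C0 + n%:R * C1) * q ^+ n) -> x = 0.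
Proof.
move=> x0 q0 q1 xle.
have p0 : 0 < 1 - q by rewrite subr_gt0.
(* Each of the [n.+1] terms of [1 + q + ... + q ^+ n] is at least [q ^+ n]. *)
have geo n : n.+1%:R * q ^+ n * (1 - q) <= 1 - q ^+ n.+1.
  elim: n => [|n IH]; first by rewrite mul1r expr0 mul1r expr1.
  have -> : n.+2%:R * q ^+ n.+1 * (1 - q) =
      q * (n.+1%:R * q ^+ n * (1 - q)) + q ^+ n.+1 * (1 - q).
    by rewrite exprS -[n.+2%:R]natr1; ring.
  rewrite (le_trans (lerD (ler_wpM2l (ltW q0) IH) (lexx _)))// -subr_ge0.
  have -> : 1 - q ^+ n.+2 - (q * (1 - q ^+ n.+1) + q ^+ n.+1 * (1 - q)) =
    (1 - q) * (1 - q ^+ n.+1) by rewrite [q ^+ n.+2]exprS; ring.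
  by rewrite mulr_ge0 ?(ltW p0)// subr_ge0 exprn_ile1 ?ltW.
pose C := `|C0| + `|C1|.
have C_ge0 : 0 <= C by rewrite addr_ge0.
have xC n : x <= C * (n.+1%:R * q ^+ n).
  rewrite (le_trans (xle n))// -(ger0_norm (le_trans x0 (xle n))) normrM mulrA.
  rewrite normrX (gtr0_norm q0) ler_wpM2r ?exprn_ge0 ?(ltW q0)//.
  rewrite (le_trans (ler_normD _ _))// normrM normr_nat mulrDl lerD//.
    by rewrite ler_peMr// ler1n.
  by rewrite mulrC ler_wpM2l// ler_nat.
pose D := C * 2 / (1 - q) + 1.
have D0 : 0 < D by rewrite ltr_wpDl// divr_ge0 ?mulr_ge0// ltW.
have xD m : x <= D * q ^+ m.
  have qm0 k : 0 <= q ^+ k by rewrite exprn_ge0 ?ltW.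
  have g : m.+1%:R * q ^+ m <= (1 - q)^-1.
    by rewrite -[leRHS]mul1r ler_pdivlMr// (le_trans (geo m))// gerBl.
  rewrite (le_trans (xC m.*2))//.
  rewrite (@le_trans _ _ (C * (2 * (1 - q)^-1 * q ^+ m)))//; last first.
    by rewrite !mulrA ler_wpM2r// lerDl.
  rewrite ler_wpM2l// -addnn exprD mulrA ler_wpM2r//.
  rewrite (@le_trans _ _ (2 * (m.+1%:R * q ^+ m)))//; last by rewrite ler_wpM2l.
  by rewrite mulrA ler_wpM2r// -natrM ler_nat addnn mul2n ltn_double.
apply/eqP; apply: contraT => xn0; have xgt0 : 0 < x by rewrite lt_def xn0.
have [N HN] := cvg_exprn_complex (ltW q0) q1 (divr_gt0 xgt0 D0).
have := HN _ (leqnn N); rewrite ltr_pdivlMr// mulrC => /(le_lt_trans (xD N)).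
by rewrite ltxx.
Qed.

Section Operators.
Context {R : realType} {H : completeNormedModType R[i]}.
Implicit Types (T S : H -> H) (A : set (H -> H)).

Lemma bounded_operatorP T : linear T ->
  continuous T <-> exists2 m : R[i], 0 < m & forall x, `|T x| <= m * `|x|.
Proof.
move=> Tlin.
pose f := HB.pack_for {linear H -> H} T (GRing.isLinear.Build R[i] H H *:%R T
  Tlin).
rewrite -[T]/(f : H -> H) -linear_bounded_continuous linear_boundedP; split.
  by move=> /pinfty_ex_gt0.
move=> [m m0 Hm]; near=> r => x; rewrite (le_trans (Hm x))// ler_wpM2r//.
by near: r; apply: nbhs_pinfty_ge; rewrite gtr0_real.
Unshelve. all: by end_near. Qed.

(** The iterates from [0] are the partial sums of the Neumann series at [y]. *)
Lemma linear_fixpoint (e : H -> H) (q : R[i]) : linear e -> 0 <= q -> q < 1 ->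
  (forall x, `|e x| <= q * `|x|) -> forall y, exists x, x = e x + y.
Proof.
move=> elin q0 q1 eq y.
pose u n := iter n (fun x => e x + y) 0.
have uS n : u n.+1 = e (u n) + y by [].
have du n : `|u n.+1 - u n| <= q ^+ n * `|y|.
  elim: n => [|n IH]; first by rewrite /u /= (lin0 elin) add0r subr0 expr0
    mul1r.
  rewrite uS [u n.+1 in X in _ - X]uS opprD addrACA subrr addr0 -(linB elin).
  by rewrite (le_trans (eq _))// exprS -mulrA ler_wpM2l.
have dun n m : `|u (n + m)%N - u n| <= q ^+ n * (`|y| / (1 - q)).
  have q1' : 0 < 1 - q by rewrite subr_gt0.
  (* The exact value of the geometric sum is kept, since the weaker bound does not pass through the
     induction on [m]. *)
  suff : `|u (n + m)%N - u n| <= q ^+ n * (`|y| / (1 - q)) * (1 - q ^+ m).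
    move/le_trans; apply; rewrite ler_piMr//.
      by rewrite mulr_ge0 ?exprn_ge0// divr_ge0// ltW.
    by rewrite gerBl exprn_ge0.
  elim: m => [|m IH]; first by rewrite addn0 subrr normr0 expr0 subrr mulr0.
  rewrite -(subrKA (u (n + m)%N)) addrC addnS (le_trans (ler_normD _ _))//.
  have -> : q ^+ n * (`|y| / (1 - q)) * (1 - q ^+ m.+1) =
    q ^+ n * (`|y| / (1 - q)) * (1 - q ^+ m) + q ^+ (n + m) * `|y|.
    by rewrite exprD exprS; field; rewrite gt_eqF.
  by rewrite lerD.
have ucvg : cvgn u.
  apply/cauchy_cvgP; apply: cauchy_exP => eps eps0.
  pose C := `|y| / (1 - q) + 1.
  have yC : `|y| / (1 - q) < C by rewrite ltrDl.
  have C0 : 0 < C by rewrite (le_lt_trans _ yC)// divr_ge0// subr_ge0 ltW.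
  have [N HN] := cvg_exprn_complex q0 q1 (divr_gt0 eps0 C0).
  exists (u N); exists N => // m /= Nm; rewrite -ball_normE /= distrC.
  rewrite -(subnKC Nm) (le_lt_trans (dun _ _))//.
  have := HN _ (leqnn N); rewrite ltr_pdivlMr// => /le_lt_trans; apply.
  by rewrite ler_wpM2l ?exprn_ge0// ltW.
have econt : continuous e.
  apply/(bounded_operatorP elin); exists 1 => // x; rewrite mul1r.
  by rewrite (le_trans (eq x))// ler_piMl// ltW.
have u1 : u n.+1 @[n --> \oo] --> limn u.
  by have := ucvg; rewrite /= -cvg_shiftS.
have u2 : u n.+1 @[n --> \oo] --> e (limn u) + y.
  apply: cvgD; last exact: cvg_cst.
  exact: (continuous_cvg _ (econt _) ucvg).
by exists (limn u); exact: (cvg_unique (@norm_hausdorff _ H) u1 u2).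
Qed.

End Operators.

(** * Adjoints and normal operators bounded below *)

Section Hilbert.
Context {R : realType} {H : completeNormedModType R[i]}.
Variable dot : {dot H for Num.conj}.
Hypothesis hdot : hilbert_dot dot.
Implicit Types (T S : H -> H) (A : set (H -> H)).

Lemma dotC x y : dot x y = Num.conj (dot y x).
Proof. by rewrite hermC expr0 mul1r. Qed.

Lemma dot_inj x y : (forall u, dot u x = dot u y) -> x = y.
Proof.
move=> h; apply/eqP; rewrite -subr_eq0 -(dnorm_eq0 dot); apply/eqP.
rewrite linearBr; apply/eqP; rewrite subr_eq0; apply/eqP; exact: h.
Qed.

Lemma is_adjoint_sym T S : is_adjoint dot T S -> is_adjoint dot S T.
Proof. by move=> h x y; rewrite dotC -h -dotC. Qed.

Lemma is_adjoint_uniq T S S' :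
  is_adjoint dot T S -> is_adjoint dot T S' -> S = S'.
Proof.
by move=> h h'; apply/funext => x; apply: dot_inj => u; rewrite -h -h'.
Qed.

Lemma adjointE T S : is_adjoint dot T S -> adjoint dot T = S.
Proof.
move=> h; apply: (@is_adjoint_uniq T) => //.
by rewrite /adjoint; case: xgetP => [S' -> //|/(_ S)].
Qed.

Lemma is_adjoint_id : is_adjoint dot id id.
Proof. by []. Qed.

Lemma is_adjoint_comp T S T' S' : is_adjoint dot T T' -> is_adjoint dot S S' ->
  is_adjoint dot (T \o S) (S' \o T').
Proof. by move=> h h' x y; rewrite /= h h'. Qed.

Lemma is_adjoint_comb (c : R[i]) T S T' S' :
  is_adjoint dot T T' -> is_adjoint dot S S' ->
  is_adjoint dot (c *: T + S) (Num.conj c *: T' + S').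
Proof.
move=> h h' x y; rewrite /GRing.add /GRing.scale /=.
by rewrite linearDl linearDr linearZl_LR linearZr_LR /= conjCK h h'.
Qed.

Lemma op_le0_adj T S : is_adjoint dot S T -> op_le dot 0 (T \o S).
Proof.
move=> h x; rewrite -[0 x]/0 linear0l /=.
by rewrite (is_adjoint_sym h) dnorm_ge0.
Qed.

(** The lower bound gives injectivity. For surjectivity, [1 - k S T] is a contraction, so [S T] is
    onto, and [T S = S T] makes [T] onto. The contraction estimate is part of the conclusion because
    it also drives the approximation of the resolvent. *)
Lemma normal_invertible T S (c : R[i]) : bounded_operator T -> linear S ->
  is_adjoint dot T S -> T \o S = S \o T ->
  0 < c -> (forall x, c * `|x| <= `|T x|) ->
  (exists2 N, bounded_operator N & inverse_of T N) /\
  exists k q : R[i], [/\ 0 < q, q < 1 &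
    forall x, `|x - k *: S (T x)| <= q * `|x|].
Proof.
move=> [Tlin Tcont] Slin adj nrm c0 Tc.
have [m0 m0_gt0 Tm0] := (bounded_operatorP Tlin).1 Tcont.
(* Adding [c] to the norm bound guarantees [k * c ^+ 2 <= 1], hence [0 < q]. *)
pose m := m0 + c.
have m_gt0 : 0 < m by rewrite addr_gt0.
have Tm x : `|T x| <= m * `|x|.
  by rewrite (le_trans (Tm0 x))// ler_wpM2r// lerDl ltW.
have nST x : `|S x| = `|T x|.
  apply/eqP; rewrite -(@eqrXn2 _ 2)// !hdot (is_adjoint_sym adj) adj.
  by rewrite -[T (S x)]/((T \o S) x) nrm.
pose k := (m ^+ 2)^-1.
have k_gt0 : 0 < k by rewrite invr_gt0 exprn_gt0.
have k_real : Num.conj k = k by apply/CrealP/gtr0_real.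
have s0 : 0 < k * c ^+ 2 by rewrite mulr_gt0// exprn_gt0.
have s1 : k * c ^+ 2 <= 1.
  rewrite /k mulrC ler_pdivrMr ?exprn_gt0// mul1r lerXn2r ?nnegrE ?ltW//.
  by rewrite /m ltrDr.
pose e := fun x => x - k *: S (T x).
(* The estimate below bounds [|e x|^2] by [(1 - k c^2) |x|^2]; this [q] avoids a square root, as
   [(1 - t / 2)^2 >= 1 - t]. *)
pose q := 1 - k * c ^+ 2 / 2.
have q0 : 0 < q.
  by rewrite subr_gt0 ltr_pdivrMr// mul1r (le_lt_trans s1)// ltr1n.
have q1 : q < 1 by rewrite ltrBlDr ltrDl divr_gt0.
have eq x : `|e x| <= q * `|x|.
  rewrite -(@ler_pXn2r _ 2)// ?nnegrE// ?mulr_ge0 ?(ltW q0)//.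
  have -> : `|e x| ^+ 2 =
      `|x| ^+ 2 - 2 * k * `|T x| ^+ 2 + k ^+ 2 * `|S (T x)| ^+ 2.
    have d : dot x (k *: S (T x)) = k * `|T x| ^+ 2.
      by rewrite linearZr_LR /= k_real hdot adj.
    have dr : Num.conj (k * `|T x| ^+ 2) = k * `|T x| ^+ 2.
      by apply/CrealP/ger0_real; rewrite mulr_ge0 ?exprn_ge0// ltW.
    rewrite [LHS]hdot dnormB d dr dnormZ -!hdot (gtr0_norm k_gt0); ring.
  rewrite nST.
  have h1 : `|T (T x)| ^+ 2 <= m ^+ 2 * `|T x| ^+ 2.
    by rewrite -exprMn lerXn2r ?nnegrE ?mulr_ge0 ?(ltW m_gt0).
  have h2 : c ^+ 2 * `|x| ^+ 2 <= `|T x| ^+ 2.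
    by rewrite -exprMn lerXn2r ?nnegrE ?mulr_ge0 ?(ltW c0).
  have h3 : k ^+ 2 * `|T (T x)| ^+ 2 <= k * `|T x| ^+ 2.
    rewrite expr2 -mulrA ler_pM2l// /k mulrC ler_pdivrMr ?exprn_gt0//.
    by rewrite mulrC.
  have h4 : k * (c ^+ 2 * `|x| ^+ 2) <= k * `|T x| ^+ 2 by rewrite ler_pM2l.
  rewrite (@le_trans _ _ ((1 - k * c ^+ 2) * `|x| ^+ 2))//.
    rewrite (@le_trans _ _ (`|x| ^+ 2 - 2 * k * `|T x| ^+ 2 + k * `|T x| ^+
      2))//.
      by rewrite lerD2l.
    rewrite -subr_ge0; rewrite -subr_ge0 in h4.
    by rewrite (le_trans h4)// le_eqVlt; apply/orP; left; apply/eqP; ring.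
  rewrite exprMn ler_wpM2r ?exprn_ge0// -subr_ge0.
  have -> : q ^+ 2 - (1 - k * c ^+ 2) = (k * c ^+ 2 / 2) ^+ 2 by rewrite /q;
    field.
  by rewrite exprn_ge0// divr_ge0// ltW.
split; last by exists k, q.
have elin : linear e.
  move=> a x y; rewrite /e (linD Tlin) (linZ Tlin) (linD Slin) (linZ Slin).
  by rewrite scalerDr opprD addrACA scalerBr !scalerA [k * a]mulrC.
have surj y : exists x, T x = y.
  have [x xe] := linear_fixpoint elin (ltW q0) q1 eq y.
  exists (S (k *: x)).
  rewrite -[T _]/((T \o S) (k *: x)) nrm /= (linZ Tlin) (linZ Slin).
  move: xe; rewrite /e -addrA -{1}[x]addr0 => /addrI/esym/eqP.
  by rewrite addrC subr_eq0 => /eqP ->.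
have [N TN] := choice surj.
have inj x y : T x = T y -> x = y.
  move=> Txy; apply/eqP; rewrite -subr_eq0 -normr_eq0 eq_le normr_ge0 andbT.
  by have := Tc (x - y); rewrite (linB Tlin) Txy subrr normr0 pmulr_rle0.
have Nlin : linear N.
  by move=> a x y; apply: inj; rewrite TN (linD Tlin) (linZ Tlin) !TN.
exists N.
  split => //; apply/(bounded_operatorP Nlin); exists c^-1;
    first by rewrite invr_gt0.
  by move=> x; rewrite ler_pdivlMl// (le_trans (Tc _))// TN.
by split; apply/funext => x /=; [rewrite TN|apply: inj; rewrite TN].
Qed.

End Hilbert.

(** * Von Neumann algebras and norm bounds for the state *)

Section OperatorAlgebras.
Context {R : realType} {H : completeNormedModType R[i]}.
Variable dot : {dot H for Num.conj}.
Hypothesis hdot : hilbert_dot dot.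
Implicit Types (T S : H -> H) (A : set (H -> H)).

Lemma op_combr T (c : R[i]) S U : linear T ->
  T \o (c *: S + U) = c *: (T \o S) + (T \o U).
Proof. by move=> l; apply/funext => x; exact: l. Qed.

Lemma bounded_operator_comb (c : R[i]) S T :
  bounded_operator S -> bounded_operator T -> bounded_operator (c *: S + T).
Proof.
move=> [Sl Sc] [Tl Tc]; split => [a x y|x].
  rewrite -[LHS]/(c *: S (a *: x + y) + T (a *: x + y)) Sl Tl.
  rewrite -[RHS]/(a *: (c *: S x + T x) + (c *: S y + T y)).
  by rewrite !scalerDr !scalerA [c * a]mulrC addrACA.
apply: cvgD; last exact: Tc.
by apply: cvgZ; [exact: cvg_cst|exact: Sc].
Qed.

Lemma bounded_operator_comp S T :
  bounded_operator S -> bounded_operator T -> bounded_operator (S \o T).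
Proof.
move=> [Sl Sc] [Tl Tc]; split => [a x y|x]; first by rewrite /= Tl Sl.
by apply: continuous_comp; [exact: Tc|exact: Sc].
Qed.

Lemma bounded_operator_id : bounded_operator (id : H -> H).
Proof. by split => // x; exact: cvg_id. Qed.

Lemma commutant_subalgebra A : A `<=` bounded_operator ->
  unital_subalgebra (commutant A).
Proof.
move=> Ab; split.
- by split => //; exact: bounded_operator_id.
- move=> c S T [Sb Sc] [Tb Tc]; split; first exact: bounded_operator_comb.
  move=> U AU; rewrite op_combr; last by have [] := Ab _ AU.
  by rewrite -(Sc _ AU) -(Tc _ AU).
- move=> S T [Sb Sc] [Tb Tc]; split; first exact: bounded_operator_comp.
  move=> U AU; apply/funext => x /=.
  have SU y : S (U y) = U (S y) by exact: (congr1 (@^~ y) (Sc _ AU)).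
  have TU y : T (U y) = U (T y) by exact: (congr1 (@^~ y) (Tc _ AU)).
  by rewrite TU SU.
Qed.

Section VonNeumann.
Variable A : set (H -> H).
Hypothesis hA : von_neumann_algebra dot A.

Lemma vn_bounded T : A T -> bounded_operator T.
Proof. by have [+ _ _] := hA; apply. Qed.

Lemma vn_linear T : A T -> linear T.
Proof. by move=> /vn_bounded []. Qed.

Lemma vn_subalgebra : unital_subalgebra A.
Proof.
have [_ _ <-] := hA; apply: commutant_subalgebra => T; first by case.
Qed.

Lemma vn_id : A id. Proof. by have [] := vn_subalgebra. Qed.

Lemma vn_comb (c : R[i]) S T : A S -> A T -> A (c *: S + T).
Proof. by have [_ + _] := vn_subalgebra; apply. Qed.

Lemma vn_0 : A 0.
Proof.
have Aid := vn_id; rewrite -(addNr (id : H -> H)) -scaleN1r; exact: vn_comb.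
Qed.

Lemma vn_scale (c : R[i]) T : A T -> A (c *: T).
Proof. by move=> AT; rewrite -[c *: T]addr0; apply: vn_comb => //;
  exact: vn_0. Qed.

Lemma vn_sub S T : A S -> A T -> A (S - T).
Proof. by move=> AS AT; rewrite addrC -scaleN1r; exact: vn_comb. Qed.

Lemma vn_comp S T : A S -> A T -> A (S \o T).
Proof. by have [_ _] := vn_subalgebra; apply. Qed.

Lemma vn_adjoint T : A T -> A (adjoint dot T) /\ is_adjoint dot T (adjoint dot
  T).
Proof. by have [_ + _] := hA => /[apply] -[S AS h]; rewrite (adjointE h). Qed.

(** Whatever commutes with [T] commutes with its inverse, which therefore lies in the
    bicommutant. *)
Lemma vn_inverse T N : A T -> bounded_operator N -> inverse_of T N -> A N.
Proof.
move=> AT Nb [TN NT]; have [_ _ <-] := hA; split => // S [[Sl _] Sc].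
apply/funext => x /=.
have ST y : S (T y) = T (S y) by exact: (congr1 (@^~ y) (Sc _ AT)).
have TNx y : T (N y) = y by exact: (congr1 (@^~ y) TN).
have NTx y : N (T y) = y by exact: (congr1 (@^~ y) NT).
by rewrite -{1}[x]TNx ST NTx.
Qed.

Lemma normal_inverse T S (c : R[i]) : A T -> A S ->
  is_adjoint dot T S -> T \o S = S \o T ->
  0 < c -> (forall x, c * `|x| <= `|T x|) ->
  (exists2 N, A N & inverse_of T N) /\
  exists k q : R[i], [/\ 0 < q, q < 1 &
    forall x, `|x - k *: S (T x)| <= q * `|x|].
Proof.
move=> AT AS adj nrm c0 Tc.
have [[N Nb NT] kq] :=
  normal_invertible hdot (vn_bounded AT) (vn_linear AS) adj nrm c0 Tc.
by split => //; exists N => //; exact: vn_inverse NT.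
Qed.

Variable phi : (H -> H) -> R[i].
Hypothesis hphi : faithful_normal_tracial_state dot A phi.

Lemma state_adj_ge0 T S : A T -> A S -> is_adjoint dot T S -> 0 <= phi (S \o T).
Proof.
move=> AT AS h; apply: (state_positive hphi); first exact: vn_comp.
exact: op_le0_adj.
Qed.

Lemma state_sqr T S (a : R[i]) : A T -> A S -> is_adjoint dot T S ->
  0 <= `|a| ^+ 2 + Num.conj a * phi T + a * phi S + phi (S \o T).
Proof.
move=> AT AS h.
have Aid := vn_id.
have := state_adj_ge0 (vn_comb a Aid AT) (vn_comb (Num.conj a) Aid AS)
  (is_adjoint_comb a (is_adjoint_id dot) h).
rewrite -[(_ + S) \o _]/(Num.conj a *: (a *: id + T) + (S \o (a *: id + T))).
rewrite op_combr; last exact: vn_linear.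
rewrite !(state_linear hphi) ?(state_unit hphi) ?mulr1//; last 3 first.
- exact: vn_comp.
- exact: vn_comb.
- by apply: vn_comb => //; exact: vn_comp.
by rewrite mulrDr -normCKC !addrA.
Qed.

(** Polarization: a nonnegative complex number is real, so the imaginary parts of [state_sqr] at
    [a = 1] and [a = i] give two real equations. *)
Lemma state_adj T S : A T -> A S -> is_adjoint dot T S ->
  phi S = Num.conj (phi T).
Proof.
move=> AT AS h; have h1 := state_sqr 1 AT AS h.
have hi := state_sqr 'i%C AT AS h.
have h0 := state_adj_ge0 AT AS h.
move: h1 hi h0; case: (phi T) (phi S) (phi (S \o T)) => [a1 a2] [b1 b2] [c1 c2].
rewrite !lecE; simpc => /andP[/eqP/= h2 _] /andP[/eqP/= h3 _] /andP[/eqP/= h4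
  _].
by congr (_ +i* _)%C; lra.
Qed.

(** Taking [a = - phi T] in [state_sqr] is the Cauchy-Schwarz inequality [|phi T|^2 <= phi (S T)]
    with [S] the adjoint of [T]; then [S T <= m^2]. *)
Lemma state_bound T (m : R[i]) : A T -> 0 <= m -> (forall x,
  `|T x| <= m * `|x|) ->
  `|phi T| <= m.
Proof.
move=> AT m0 Tm; have [AS h] := vn_adjoint AT; set S := adjoint dot T in AS h.
have := state_sqr (- phi T) AT AS h.
rewrite (state_adj AT AS h) normrN rmorphN /= !mulNr -normCKC -normCK.
rewrite subrr sub0r addrC subr_ge0 => le1.
rewrite -(@ler_pXn2r _ 2)// ?nnegrE// (le_trans le1)//.
have Aid := vn_id; have AST := vn_comp AS AT.
(* The operator [m^2] is written as [(m^2 - 1) id + id] to fit the form [c *: S + T] of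
   linearity. *)
have := state_linear hphi (-1) AST (vn_comb (m ^+ 2 - 1) Aid Aid).
rewrite [phi ((_ - 1) *: _ + _)](state_linear hphi)// (state_unit hphi).
rewrite mulr1 subrK mulN1r => E; rewrite -subr_ge0 addrC -E;
  apply: (state_positive hphi).
  exact/vn_comb/vn_comb.
move=> x; rewrite -[0 x]/0 linear0l.
rewrite -[X in dot X x]/(-1 *: S (T x) + ((m ^+ 2 - 1) *: x + x)).
rewrite -[X in _ + (_ + X)]scale1r -scalerDl subrK scaleN1r addrC linearBl.
rewrite linearZl_LR /= (is_adjoint_sym h) -!hdot subr_ge0 -exprMn.
by rewrite lerXn2r ?nnegrE ?mulr_ge0.
Qed.

End VonNeumann.
End OperatorAlgebras.

(** * Scalar shifts of a self-adjoint operator *)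

Section SelfAdjoint.
Context {R : realType} {H : completeNormedModType R[i]}.
Variable dot : {dot H for Num.conj}.
Hypothesis hdot : hilbert_dot dot.

Lemma conj_complexE (z : R[i]) : Num.conj z = conjc z.
Proof. by []. Qed.

(** Pythagoras: [Re z - S] is symmetric and [i Im z] is imaginary, so the cross terms of the squared
    norm cancel. *)
Lemma self_adjoint_shift_bound (S : H -> H) (z : R[i]) (x : H) :
  self_adjoint dot S -> `|(complex.Im z)%:C%C| * `|x| <= `|z *: x - S x|.
Proof.
move=> Ssa; pose a := (complex.Re z)%:C%C; pose b := ('i * (complex.Im z)%:C)%C.
have zE : z *: x - S x = (a *: x - S x) + b *: x.
  by rewrite {1}[z]complexE scalerDl addrAC.
have aJ : Num.conj a = a by rewrite conj_complexE conjc_real.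
have bJ : Num.conj b = - b.
  by rewrite conj_complexE; apply/eqP; rewrite eq_complex /=; apply/andP; split;
    apply/eqP; ring.
have nb : `|b| = `|(complex.Im z)%:C%C|.
  by rewrite normrM [`|_|]normc_def /= expr0n expr1n add0r sqrtr1 mul1r.
have tJ : Num.conj (dot (a *: x - S x) x) = dot (a *: x - S x) x.
  rewrite -dotC linearBr linearBl linearZl_LR linearZr_LR /= aJ.
  by rewrite Ssa.
have dE : dot (a *: x - S x) (b *: x) = - b * dot (a *: x - S x) x.
  by rewrite linearZr_LR /= bJ.
have dJ : Num.conj (- b * dot (a *: x - S x) x) = b * dot (a *: x - S x) x.
  by rewrite rmorphM rmorphN /= bJ tJ opprK.
rewrite -(@ler_pXn2r _ 2)// ?nnegrE// ?mulr_ge0// exprMn zE -nb.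
rewrite [leRHS]hdot dnormD dE dJ mulNr addNr addr0 dnormZ -!hdot lerDr.
by rewrite exprn_ge0.
Qed.

Lemma self_adjoint_shift (S : H -> H) (z : R[i]) : self_adjoint dot S ->
  is_adjoint dot (z *: (id : H -> H) - S) (Num.conj z *: (id : H -> H) - S).
Proof.
move=> Ssa x y; rewrite /= -[X in dot X y]/(z *: x - S x) .
rewrite -[X in dot x X]/(Num.conj z *: y - S y).
rewrite linearBr linearBl linearZl_LR linearZr_LR /= conjCK Ssa//.
Qed.

Lemma shift_comm (S : H -> H) (a b : R[i]) : linear S ->
  (a *: (id : H -> H) - S) \o (b *: id - S) =
  (b *: (id : H -> H) - S) \o (a *: id - S).
Proof.
move=> Sl.
apply/funext => x; rewrite /= -[LHS]/(a *: (b *: x - S x) - S (b *: x - S x)).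
rewrite -[RHS]/(b *: (a *: x - S x) - S (a *: x - S x)).
by rewrite !(linB Sl) !(linZ Sl) !scalerBr !scalerA !opprB
  addrACA [RHS]addrACA [a * b]mulrC [- (a *: _) + _]addrC.
Qed.

End SelfAdjoint.

(** * Subordination of operators *)

Section OperatorSubordination.
Context {R : realType} {H : completeNormedModType R[i]}.
Variable dot : {dot H for Num.conj}.
Hypothesis hdot : hilbert_dot dot.
Variables (A : set (H -> H)) (phi : (H -> H) -> R[i]).
Hypothesis hA : von_neumann_algebra dot A.
Hypothesis hphi : faithful_normal_tracial_state dot A phi.

Definition opalg_pred : {pred H -> H} := fun T => `[< A T >].
(** Composition of arbitrary maps distributes over sums on one side only; on the linear members of
    [A] it is a ring product, and the algebraic sections apply to this type. *)
Definition opalg := {T : H -> H | opalg_pred T}.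

Lemma opalg_submod : submod_closed opalg_pred.
Proof.
split; first exact/asboolP/(vn_0 hA).
by move=> a u v /asboolP Au /asboolP Av; apply/asboolP; exact: (vn_comb hA).
Qed.
HB.instance Definition _ := GRing.isSubmodClosed.Build R[i] (H -> H) opalg_pred
  opalg_submod.
HB.instance Definition _ := SubChoice.on opalg.
HB.instance Definition _ := [SubChoice_isSubLmodule of opalg by <:].

Definition in_opalg T (AT : A T) : opalg := exist _ T (asboolT AT).

Lemma opalgP (x : opalg) : A (val x).
Proof. exact/asboolP/(valP x). Qed.

Definition opalg_one : opalg := in_opalg (vn_id hA).
Definition opalg_mul (x y : opalg) : opalg :=
  in_opalg (vn_comp hA (opalgP x) (opalgP y)).

Fact opalg_mulA : associative opalg_mul.
Proof. by move=> x y z; apply: val_inj. Qed.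
Fact opalg_mul1l : left_id opalg_one opalg_mul.
Proof. by move=> x; apply: val_inj. Qed.
Fact opalg_mul1r : right_id opalg_one opalg_mul.
Proof. by move=> x; apply: val_inj. Qed.
Fact opalg_mulDl : left_distributive opalg_mul +%R.
Proof. by move=> x y z; apply: val_inj. Qed.
Fact opalg_mulDr : right_distributive opalg_mul +%R.
Proof.
move=> x y z; apply: val_inj; apply/funext => u.
exact: (linD (vn_linear hA (opalgP x))).
Qed.
Fact opalg_one_neq0 : opalg_one != 0.
Proof.
apply/eqP => /(congr1 val) /= id0.
have := state_unit hphi; have Aid := vn_id hA.
have := state_linear hphi (-1) Aid Aid.
rewrite scaleN1r addNr mulN1r addNr => p0.
by rewrite id0 p0 => /esym/eqP; rewrite oner_eq0.
Qed.
HB.instance Definition _ := GRing.Zmodule_isNzRing.Build opalg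
  opalg_mulA opalg_mul1l opalg_mul1r opalg_mulDl opalg_mulDr opalg_one_neq0.
Fact opalg_scalerAl (a : R[i]) (x y : opalg) : a *: (x * y) = (a *: x) * y.
Proof. by apply: val_inj. Qed.
HB.instance Definition _ := GRing.Lmodule_isLalgebra.Build R[i] opalg
  opalg_scalerAl.
Fact opalg_scalerAr (a : R[i]) (x y : opalg) : a *: (x * y) = x * (a *: y).
Proof.
apply: val_inj; apply/funext => u; apply/esym.
exact: (linZ (vn_linear hA (opalgP x))).
Qed.
HB.instance Definition _ := GRing.Lalgebra_isAlgebra.Build R[i] opalg
  opalg_scalerAr.

Lemma val_opalg_prod (l : seq (bool * opalg)) :
  val (word l) = \big[comp/id]_(k < size l) val (nth (false, 1) l k).2.
Proof.
rewrite /word (big_nth (false, 1)) big_mkord.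
by apply: (big_morph val) => // x y.
Qed.

Definition opalg_phi (x : opalg) : R[i] := phi (val x).

Lemma opalg_phi_linear : scalar opalg_phi.
Proof. by move=> c x y; exact: (state_linear hphi _ (opalgP x) (opalgP y)). Qed.

Lemma opalg_phi1 : opalg_phi 1 = 1.
Proof. exact: (state_unit hphi). Qed.

Variables (B : set (H -> H)) (E : (H -> H) -> (H -> H)).
Hypothesis hB : von_neumann_algebra dot B.
Hypothesis hBA : B `<=` A.
Hypothesis hE : conditional_expectation dot A B phi E.
Variable Y : H -> H.
Hypotheses (hYA : A Y) (hYB : free_from phi Y B).

Definition opalg_alg (i : bool) : set opalg :=
  [set x | (if i then smallest unital_subalgebra [set Y] else B) (val x)].

Lemma opalg_alg_sub i : subalgebra (opalg_alg i).
Proof.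
suff sub : unital_subalgebra (if i then smallest unital_subalgebra [set Y] else
  B).
  have [h1 h2 h3] := sub; split=> [|c x y|x y]; [exact: h1|exact: h2|exact: h3].
case: i; last exact: (vn_subalgebra hB).
split=> [M [[]] //|c S T hS hT M [Ms MY]|S T hS hT M [Ms MY]].
  by have [_ + _] := Ms; apply; [exact: hS|exact: hT].
by have [_ _] := Ms; apply; [exact: hS|exact: hT].
Qed.

Lemma opalg_alg_free l : l != [::] -> letters opalg_alg l ->
  centered opalg_phi l -> alternating l -> opalg_phi (word l) = 0.
Proof.
move=> l0 hl hc ha; rewrite /opalg_phi val_opalg_prod.
apply: (hYB (i := fun k => (nth (false, 1) l k).1)
  (a := fun k => val (nth (false, 1) l k).2)).
- by case: (l) l0.
- by move=> k kl; split; [exact/hl/mem_nth|exact/hc/mem_nth].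
- by move=> k kl; apply/eqP; move/(sortedP (false, 1)): ha => /(_ _ kl).
Qed.

Variables (X F F' : H -> H).
Hypotheses (hXB : B X) (hXsa : self_adjoint dot X) (hYsa : self_adjoint dot Y).
Hypotheses (hFB : B F) (hF : is_adjoint dot F F') (F0 : F <> 0).

Let S := X + (F \o Y \o F').

Variable z : R[i].
Hypothesis z_gt0 : 0 < complex.Im z.

Lemma adjoint_in_B : B F'.
Proof. by have [+ _] := vn_adjoint hB hFB; rewrite (adjointE hF). Qed.

Lemma S_self_adjoint : self_adjoint dot S.
Proof.
move=> x y; rewrite -[X in dot X y]/(X x + F (Y (F' x))).
rewrite -[X in dot x X]/(X y + F (Y (F' y))) linearDl linearDr /= hXsa.
by rewrite hF hYsa (is_adjoint_sym hF).
Qed.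

Lemma S_in_A : A S.
Proof.
have AF' := hBA adjoint_in_B.
rewrite /S -[X]scale1r; apply: (vn_comb hA); first exact: hBA.
by do 2!apply: (vn_comp hA) => //; exact: hBA.
Qed.

Definition shiftS (a : R[i]) : H -> H := a *: (id : H -> H) - S.

Lemma shiftS_in_A a : A (shiftS a).
Proof.
by apply: (vn_sub hA) S_in_A; apply: (vn_scale hA); exact: vn_id hA.
Qed.

Lemma shiftS_adjoint : is_adjoint dot (shiftS z) (shiftS (Num.conj z)).
Proof. exact/self_adjoint_shift/S_self_adjoint. Qed.

Lemma shiftS_inverse : (exists2 N, A N & inverse_of (shiftS z) N) /\
  exists k q : R[i], [/\ 0 < q, q < 1 &
    forall x, `|x - k *: shiftS (Num.conj z) (shiftS z x)| <= q * `|x|].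
Proof.
apply: (normal_inverse hdot hA (c := `|(complex.Im z)%:C%C|)).
- exact: shiftS_in_A.
- exact: shiftS_in_A.
- exact: shiftS_adjoint.
- exact/shift_comm/(vn_linear hA S_in_A).
- by rewrite normr_gt0 eq_complex /= eqxx andbT gt_eqF.
- by move=> x; exact: (self_adjoint_shift_bound hdot z x S_self_adjoint).
Qed.

(** With [N'] the adjoint of [N], the resolvent identity [N - N' = (conj z - z) N' N] shows that the
    imaginary part of [phi (F' N F)] is [- Im z] times [phi (U' U)] for [U = N F] and its adjoint
    [U']. Were it zero, [U] and then [F] would vanish. *)
Lemma state_resolvent_neq0 N : A N -> inverse_of (shiftS z) N ->
  phi (F' \o N \o F) != 0.
Proof.
move=> AN [MN NM].
have [AN' adjN] := vn_adjoint hA AN; set N' := adjoint dot N in AN' adjN.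
have AF := hBA hFB; have AF' := hBA adjoint_in_B.
pose U := N \o F.
have AU : A U by exact: (vn_comp hA).
have U0 : U <> 0.
  move=> UE; apply: F0; rewrite -[F]/(id \o F) -MN -[_ \o F]/(shiftS z \o U) UE.
  by apply/funext => x /=; exact: (lin0 (vn_linear hA (shiftS_in_A z))).
have adjU : is_adjoint dot U (F' \o N') by exact: is_adjoint_comp.
apply/eqP => p0; apply: U0; apply: (state_faithful hphi) => //.
rewrite (adjointE adjU).
have N'M' : N' \o shiftS (Num.conj z) = id.
  apply: (@is_adjoint_uniq _ _ dot (shiftS z \o N)).
    by apply: is_adjoint_comp => //; exact: shiftS_adjoint.
  by rewrite MN; exact: is_adjoint_id.
have AW : A ((F' \o N') \o U) by do 2!apply: (vn_comp hA) => //.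
have AV : A ((F' \o N') \o F) by do 2!apply: (vn_comp hA) => //.
have pV : phi ((F' \o N') \o F) = 0.
  rewrite (@state_adj _ _ dot _ hA _ hphi (F' \o N \o F))//.
  - by rewrite p0 rmorph0.
  - by do 2!apply: (vn_comp hA) => //.
  - apply: is_adjoint_comp (hF); apply: is_adjoint_comp adjN.
    exact: (is_adjoint_sym hF).
have := state_linear hphi (Num.conj z - z) AW AV.
rewrite pV addr0.
have -> : (Num.conj z - z) *: ((F' \o N') \o U) + ((F' \o N') \o F) = F' \o N
  \o F.
  apply/funext => x.
  rewrite -[LHS]/((Num.conj z - z) *: F' (N' (N (F x))) + F' (N' (F x))) /=.
  have Fl := vn_linear hA AF'; have Nl := vn_linear hA AN'.
  rewrite -(linZ Fl) -(linZ Nl) -(linD Fl) -(linD Nl); congr (F' _).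
  rewrite -[RHS]/(id (N (F x))) -N'M' /=; congr (N' _).
  have {2}-> : F x = shiftS z (N (F x)) by exact: (esym (congr1 (@^~ (F x))
    MN)).
  rewrite -[shiftS z _]/(z *: N (F x) - S (N (F x))) addrA -scalerDl subrK.
  by [].
rewrite p0 => /esym/eqP; rewrite mulf_eq0 => /orP[|/eqP//].
rewrite subr_eq0 conj_complexE; case: (z) z_gt0 => a b /= b0.
by rewrite eq_complex /= eqxx /= eqNr gt_eqF.
Qed.

Lemma free_resolvent_identity N a b : A N -> inverse_of (shiftS z) N -> B a ->
  B b ->
  phi (a \o N \o F \o Y) * phi (F' \o N \o b) =
  phi (a \o N \o F) * phi (Y \o F' \o N \o b).
Proof.
move=> AN [MN NM] Ba Bb.
have [_ [k [q [q0 q1 ek]]]] := shiftS_inverse.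
have AF := hBA hFB; have AF' := hBA adjoint_in_B.
pose oX := in_opalg (hBA hXB); pose oY := in_opalg hYA.
pose oF := in_opalg AF; pose oF' := in_opalg AF'; pose oN := in_opalg AN.
pose oa := in_opalg (hBA Ba); pose ob := in_opalg (hBA Bb).
pose e : opalg := 1 - k *: ((Num.conj z *: 1 - (oX + oF * oY * oF')) *
  (z *: 1 - (oX + oF * oY * oF'))).
have e_bound n x : `|val (e ^+ n) x| <= q ^+ n * `|x|.
  elim: n x => [|n IH] x; first by rewrite expr0 mul1r.
  rewrite exprS -[val _ x]/(val e (val (e ^+ n) x)) exprS -mulrA.
  by apply: (le_trans (ek (val (e ^+ n) x))); rewrite ler_wpM2l// ltW.
have e_decay u v : exists2 C : R[i], 0 <= C &
    forall n, `|opalg_phi (u * e ^+ n * v)| <= C * q ^+ n.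
  have bnd (x : opalg) := (bounded_operatorP (vn_linear hA (opalgP x))).1
    (vn_bounded hA (opalgP x)).2.
  have [mu mu0 hu] := bnd u; have [mv mv0 hv] := bnd v.
  exists (mu * mv) => [|n]; first by rewrite mulr_ge0 ?ltW.
  apply: (state_bound hdot hA hphi); first exact: opalgP.
    by rewrite !mulr_ge0 ?exprn_ge0 ?ltW.
  move=> x; rewrite -[val _ x]/(val u (val (e ^+ n) (val v x))).
  rewrite (le_trans (hu _))// -mulrA -mulrA ler_pM2l// mulrCA.
  by rewrite (le_trans (e_bound _ _))// ler_pM2l ?exprn_gt0.
have rz : oN * (z *: 1 - (oX + oF * oY * oF')) = 1 by exact: val_inj.
have zr : (z *: 1 - (oX + oF * oY * oF')) * oN = 1 by exact: val_inj.
have oYtrue : opalg_alg true oY by move=> M [_]; exact.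
have [C0 [C1 HC]] := free_resolvent_decay opalg_phi_linear opalg_phi1
  opalg_alg_sub opalg_alg_free (hXB : opalg_alg false oX) oYtrue
  (hFB : opalg_alg false oF) (adjoint_in_B : opalg_alg false oF')
  zr (Bb : opalg_alg false ob) q0 e_decay (Ba : opalg_alg false oa).
have := linear_geometric_eq0 (normr_ge0 _) q0 q1 HC.
by move=> /eqP; rewrite normr_eq0 subr_eq0 => /eqP.
Qed.

Definition opalg_condexp (x : opalg) : opalg :=
  in_opalg (hBA (condexp_range hE (opalgP x))).

Theorem operator_subordination : exists N c,
  [/\ A N, inverse_of (shiftS z) N &
      inverse_of (z *: (id : H -> H) - X - c *: (F \o F')) (E N)].
Proof.
have [[N AN MN] _] := shiftS_inverse; have [MN1 NM1] := MN.
have AF := hBA hFB; have AF' := hBA adjoint_in_B.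
pose oX := in_opalg (hBA hXB); pose oY := in_opalg hYA.
pose oF := in_opalg AF; pose oF' := in_opalg AF'; pose oN := in_opalg AN.
have EB x : opalg_alg false (opalg_condexp x).
  exact: (condexp_range hE (opalgP x)).
have E1 : opalg_condexp 1 = 1.
  by apply: val_inj; exact: (condexp_id hE (vn_id hB)).
have E_lin : linear opalg_condexp.
  by move=> c x y; apply: val_inj;
    exact: (condexp_linear hE c (opalgP x) (opalgP y)).
have E_bim a x b : opalg_alg false a -> opalg_alg false b ->
    opalg_condexp (a * x * b) = a * opalg_condexp x * b.
  by move=> Ba Bb; apply: val_inj;
    exact: (condexp_bimodule hE Ba (opalgP x) Bb).
have phiE x : opalg_phi (opalg_condexp x) = opalg_phi x.
  exact: (condexp_state hE (opalgP x)).
have faith_l u : opalg_alg false u ->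
    (forall a, opalg_alg false a -> opalg_phi (a * u) = 0) -> u = 0.
  move=> Bu hu; apply: val_inj; apply: (state_faithful hphi);
    first exact: opalgP.
  have [Bu' _] := vn_adjoint hB Bu.
  exact: (hu (in_opalg (hBA Bu')) Bu').
have faith_r u : opalg_alg false u ->
    (forall b, opalg_alg false b -> opalg_phi (u * b) = 0) -> u = 0.
  (* Traciality turns testing on the right into testing on the left. *)
  move=> Bu hu; apply: faith_l => // a Ba; rewrite -(hu a Ba).
  exact: (state_tracial hphi (opalgP a) (opalgP u)).
have rz : oN * (z%:A - (oX + oF * oY * oF')) = 1 by exact: val_inj.
have zr : (z%:A - (oX + oF * oY * oF')) * oN = 1 by exact: val_inj.
have th0 a b : opalg_alg false a -> opalg_alg false b ->
    theta opalg_phi oY oF oF' (a * oN) (oN * b) = 0.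
  move=> Ba Bb; apply/eqP; rewrite subr_eq0; apply/eqP.
  exact: (free_resolvent_identity AN MN Ba Bb).
have nz : opalg_phi (oF' * oN * oF) != 0 by exact: (state_resolvent_neq0 AN MN).
pose c := subordination opalg_phi oY oF oF' oN.
exists N, c; split => //.
have DG := condexp_resolvent_mulr opalg_phi_linear (opalg_alg_sub false) EB E1
  E_lin E_bim phiE faith_r (hXB : opalg_alg false oX) (hFB : opalg_alg false oF)
  (adjoint_in_B : opalg_alg false oF') zr th0 nz.
have GD := condexp_resolvent_mull opalg_phi_linear (opalg_alg_sub false) EB E1
  E_lin E_bim phiE faith_l (hXB : opalg_alg false oX) (hFB : opalg_alg false oF)
  (adjoint_in_B : opalg_alg false oF') rz th0 nz.
by split; [exact: (congr1 val DG)|exact: (congr1 val GD)].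
Qed.

End OperatorSubordination.

(** * Borel functional calculus *)

Section BorelCalculus.
Context {R : realType} {H : completeNormedModType R[i]}.
Variable dot : {dot H for Num.conj}.
Hypothesis hdot : hilbert_dot dot.
Variables (A : set (H -> H)) (X : H -> H).
Hypotheses (hA : von_neumann_algebra dot A) (hXA : A X).
Hypothesis hXsa : self_adjoint dot X.

Let D := spectrum A X.

(** Since [t - X] is normal, a lower bound alone makes it invertible in [A]. *)
Lemma shift_not_spectrum (t c : R[i]) : 0 < c ->
  (forall x, c * `|x| <= `|t *: x - X x|) -> ~ D t.
Proof.
move=> c0 hc; apply; apply: (normal_inverse hdot hA (T := t *: (id : H -> H) -
  X)
  (S := Num.conj t *: (id : H -> H) - X) (c := c) _ _ _ _ c0 hc).1.
- by apply: (vn_sub hA) hXA; apply: (vn_scale hA); exact: vn_id hA.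
- apply: (vn_sub hA) hXA; apply: (vn_scale hA); exact: vn_id hA.
- exact: self_adjoint_shift.
- exact/shift_comm/(vn_linear hA hXA).
Qed.

Lemma spectrum_real t : D t -> complex.Im t = 0.
Proof.
move=> Dt; apply/eqP; apply: contraPT Dt => t0.
apply: (@shift_not_spectrum t `|(complex.Im t)%:C%C|).
  by rewrite normr_gt0 eq_complex /= eqxx andbT.
by move=> x; exact: (self_adjoint_shift_bound hdot t x hXsa).
Qed.

Lemma spectrum_bounded : exists2 m : R[i], 0 < m & forall t, D t -> `|t| <= m.
Proof.
have [m m0 Xm] := (bounded_operatorP (vn_linear hA hXA)).1 (vn_bounded hA
  hXA).2.
exists m => // t; have [//|mt] := real_leP (normr_real t) (gtr0_real m0).
move=> Dt; exfalso; apply: (shift_not_spectrum (c := `|t| - m)) Dt;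
  first by rewrite subr_gt0.
move=> x; rewrite mulrBl -normrZ (le_trans _ (lerB_dist _ _))//.
by rewrite lerD2l lerN2.
Qed.

(** * Borel sets and Borel functions on the spectrum *)

Notation sigma := (<<s @open R[i]^o >>).

Lemma sigma_open (U : set R[i]^o) : open U -> sigma U.
Proof. exact: sub_gen_smallest. Qed.

Lemma sigma_setC (U : set R[i]^o) : sigma U -> sigma (~` U).
Proof.
by have [_ h _] := smallest_sigma_algebra setT (@open R[i]^o) => /h;
  rewrite setTD.
Qed.

Lemma sigma_bigcup (F : nat -> set R[i]^o) :
  (forall n, sigma (F n)) -> sigma (\bigcup_n F n).
Proof. by have [_ _ h] := smallest_sigma_algebra setT (@open R[i]^o) => /h. Qed.

Lemma sigma_setU (U V : set R[i]^o) : sigma U -> sigma V -> sigma (U `|` V).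
Proof.
move=> sU sV; rewrite -bigcup2E; apply: sigma_bigcup => -[//|[//|n]] /=.
by apply: sigma_open; exact: open0.
Qed.

Lemma sigma_setI (U V : set R[i]^o) : sigma U -> sigma V -> sigma (U `&` V).
Proof.
move=> sU sV; rewrite -[U `&` V]setCK setCI.
by apply: sigma_setC; apply: sigma_setU; exact: sigma_setC.
Qed.

Hypothesis sigma_D : sigma D.

Lemma borel_continuous (g : R[i] -> R[i]) :
  continuous (g : R[i]^o -> R[i]^o) ->
  (exists M : R[i], forall t, D t -> `|g t| <= M) -> bounded_borel_on D g.
Proof.
move=> gc gM; split => // U Uo; apply: sigma_setI => //; apply: sigma_open.
by move/continuousP: gc; apply.
Qed.

Lemma borel_indic_add (c : R[i]) (S : set R[i]) (g : R[i] -> R[i]) : sigma S ->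
  bounded_borel_on D g -> bounded_borel_on D (fun t => c * \1_S t + g t).
Proof.
move=> sS [[M gM] gb]; split.
  exists (`|c| + M) => t Dt; rewrite (le_trans (ler_normD _ _))// lerD ?gM//.
  rewrite normrM indicE; case: (t \in S); rewrite ?normr1 ?mulr1// normr0 mulr0.
  exact: normr_ge0.
move=> U Uo.
have -> : D `&` (fun t => c * \1_S t + g t) @^-1` U =
    (S `&` (D `&` g @^-1` [set u | U (c + u)])) `|` (~` S `&` (D `&` g @^-1`
      U)).
  apply/seteqP; split => t /=.
    move=> [Dt]; rewrite indicE; have [tS|tS] := boolP (t \in S).
      by rewrite mulr1 => Ut; left; split => //; exact: set_mem.
    by rewrite mulr0 add0r => Ut; right; split => //; rewrite -in_setC in tS;
      exact: set_mem.
  move=> [[St [Dt Ut]]|[St [Dt Ut]]]; split => //.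
    by rewrite indicE mem_set// mulr1.
  by rewrite indicE memNset// mulr0 add0r.
apply: sigma_setU; apply: sigma_setI; [exact: sS| |exact: sigma_setC|exact: gb].
apply: gb; have cc : continuous (fun u : R[i]^o => c + u : R[i]^o).
  move=> u; apply: (@continuousD _ R[i]^o R[i]^o (fun=> c) id u);
    [exact: cst_continuous|move=> ?; exact: cvg_id].
by move/continuousP: cc; apply.
Qed.

Lemma borel_zero : bounded_borel_on D (fun=> 0).
Proof.
apply: borel_continuous; first exact: cst_continuous.
by exists 0 => t _; rewrite normr0.
Qed.

Lemma borel_indic (S : set R[i]) : sigma S -> bounded_borel_on D \1_S.
Proof.
move=> sS; have := borel_indic_add 1 sS borel_zero.
by under eq_fun do rewrite mul1r addr0.
Qed.

(** * Functions of [X] that commute with an operator commuting with [X] *)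

Variable Phi : (R[i] -> R[i]) -> (H -> H).
Hypothesis hPhi : borel_functional_calculus dot A X Phi.
Variable T : H -> H.
Hypotheses (hTb : bounded_operator T) (hTX : T \o X = X \o T).

Definition commuting (g : R[i] -> R[i]) :=
  bounded_borel_on D g /\ T \o Phi g = Phi g \o T.

Lemma commuting_cvg (gn : nat -> R[i] -> R[i]) g (M : R[i]) :
  (forall n, commuting (gn n)) -> bounded_borel_on D g ->
  (forall n t, D t -> `|gn n t| <= M) ->
  (forall t, D t -> (gn n t : R[i]^o) @[n --> \oo] --> (g t : R[i]^o)) ->
  commuting g.
Proof.
move=> cgn bg gnM gng; split => //; apply/funext => x /=.
have cv y := fc_cvg hPhi (fun n => (cgn n).1) bg gnM gng y.
have c1 : T (Phi (gn n) x) @[n --> \oo] --> T (Phi g x).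
  exact: (continuous_cvg _ (hTb.2 _) (cv x)).
have c2 : T (Phi (gn n) x) @[n --> \oo] --> Phi g (T x).
  have E n : T (Phi (gn n) x) = Phi (gn n) (T x).
    exact: (congr1 (@^~ x) (cgn n).2).
  by under eq_cvg do rewrite E; exact: cv.
exact: (cvg_unique (@norm_hausdorff _ H) c1 c2).
Qed.

(** The constant sequence [g] converges to [h] on the spectrum, so values elsewhere do not
    matter. *)
Lemma commuting_ext g h : commuting g -> bounded_borel_on D h ->
  (forall t, D t -> g t = h t) -> commuting h.
Proof.
move=> cg bh gh; have [[M gM] _] := cg.1.
apply: (commuting_cvg (gn := fun=> g) (M := M)) => // t Dt.
by rewrite gh//; exact: cvg_cst.
Qed.

Lemma commuting_comb (c : R[i]) g h : commuting g -> commuting h ->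
  bounded_borel_on D (fun t => c * g t + h t) ->
  commuting (fun t => c * g t + h t).
Proof.
move=> [bg cg] [bh ch] bgh; split => //.
rewrite (fc_linear hPhi c bg bh) op_combr; last by have [] := hTb.
by rewrite cg ch.
Qed.

Lemma commuting_mul g h : commuting g -> commuting h ->
  bounded_borel_on D (fun t => g t * h t) -> commuting (fun t => g t * h t).
Proof.
move=> [bg cg] [bh ch] bgh; split => //; rewrite (fc_mul hPhi bg bh).
apply/funext => x /=.
have cg' y : T (Phi g y) = Phi g (T y) by exact: (congr1 (@^~ y) cg).
have ch' y : T (Phi h y) = Phi h (T y) by exact: (congr1 (@^~ y) ch).
by rewrite cg' ch'.
Qed.

(** Carrying continuity along yields the measurability of sums and products that [commuting_comb]
    and [commuting_mul] ask for. *)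
Definition bounded_continuous (g : R[i] -> R[i]) :=
  continuous (g : R[i]^o -> R[i]^o) /\
  (exists M : R[i], forall t, D t -> `|g t| <= M).

Lemma bounded_continuous_comb (c : R[i]) g h : bounded_continuous g ->
  bounded_continuous h -> bounded_continuous (fun t => c * g t + h t).
Proof.
move=> [cg [M gM]] [ch [N hN]]; split.
  move=> t; apply: (@continuousD _ R[i]^o R[i]^o (fun t => c * g t) h t).
    apply: (@continuousM _ R[i]^o (fun=> c) g t); first exact: cst_continuous.
    exact: cg.
  exact: ch.
exists (`|c| * M + N) => t Dt; rewrite (le_trans (ler_normD _ _))// lerD ?hN//.
by rewrite normrM ler_wpM2l// gM.
Qed.

Lemma bounded_continuous_mul g h : bounded_continuous g ->
  bounded_continuous h -> bounded_continuous (fun t => g t * h t).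
Proof.
move=> [cg [M gM]] [ch [N hN]]; split.
  by move=> t; apply: (@continuousM _ R[i]^o g h t); [exact: cg|exact: ch].
exists (M * N) => t Dt; rewrite normrM ler_pM// ?gM ?hN//.
Qed.

Lemma bounded_continuous_cst c : bounded_continuous (fun=> c).
Proof. by split; [exact: cst_continuous|exists `|c|]. Qed.

Lemma bounded_continuous_id : bounded_continuous id.
Proof.
split; first by move=> t ?; exact.
by have [m _ hm] := spectrum_bounded; exists m.
Qed.

Lemma commuting_one : commuting (cst 1).
Proof.
split; last by rewrite (fc_one hPhi).
by apply: borel_continuous; have [] := bounded_continuous_cst 1.
Qed.

Lemma commuting_id : commuting id.
Proof.
split; last by rewrite (fc_id hPhi).
by apply: borel_continuous; have [] := bounded_continuous_id.
Qed.

(* The iterates converge to the sign function on [[-1, 1]]. *)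
Definition smoothstep (K : fieldType) (v : K) : K := v * (3 - v ^+ 2) / 2.

(** As [1 - smoothstep u = (1 - u)^2 (2 + u) / 2], the distance to [1] shrinks by a factor of at
    most [1 - v / 2] while [u >= v]. The rate depends on [v], but only bounded pointwise convergence
    is required. *)
Lemma smoothstep_iter_gt0 (v : R) n : 0 < v -> v <= 1 ->
  v <= iter n (@smoothstep R) v <= 1 /\
  1 - iter n (@smoothstep R) v <= (1 - v / 2) ^+ n.
Proof.
move=> v0 v1; elim: n => [|n [/andP[h1 h2] h3]].
  by rewrite expr0 /= lexx v1; split => //; rewrite gerBl ltW.
rewrite iterS; set u := iter n _ v in h1 h2 h3 *.
have E : 1 - smoothstep u = (1 - u) * ((1 - u) * (2 + u) / 2).
  by rewrite /smoothstep; field.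
have h4 : (1 - u) * (2 + u) / 2 <= 1 - v / 2.
  by rewrite ler_pdivrMr//; nra.
have h5 : 0 <= (1 - u) * (2 + u) / 2 by rewrite divr_ge0//; nra.
have h6 : 0 <= 1 - u by rewrite subr_ge0.
have h7 : u <= smoothstep u.
  by rewrite /smoothstep ler_pdivlMr//; nra.
have h8 : 0 <= 1 - smoothstep u by rewrite E mulr_ge0.
split; first by rewrite (le_trans h1 h7) -subr_ge0.
by rewrite E exprSr ler_pM.
Qed.

Lemma smoothstep_iterN (v : R) n :
  iter n (@smoothstep R) (- v) = - iter n (@smoothstep R) v.
Proof. by elim: n => // n IH; rewrite !iterS IH /smoothstep sqrrN mulNr mulNr.
  Qed.

Lemma smoothstep_iter0 n : iter n (@smoothstep R) 0 = 0.
Proof. by elim: n => // n IH; rewrite iterS IH /smoothstep !mul0r. Qed.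

Lemma smoothstep_iter_norm (v : R) n : `|v| <= 1 ->
  `|iter n (@smoothstep R) v| <= 1.
Proof.
move=> v1; elim: n => // n; rewrite iterS; set u := iter n _ v.
rewrite !ler_norml /smoothstep => /andP[h1 h2].
(* The two products are [2 (1 + smoothstep u)] and [2 (1 - smoothstep u)]. *)
have e1 : 0 <= (u + 1) ^+ 2 * (2 - u) by rewrite mulr_ge0 ?sqr_ge0//; lra.
have e2 : 0 <= (1 - u) ^+ 2 * (2 + u) by rewrite mulr_ge0 ?sqr_ge0//; lra.
by rewrite ler_pdivlMr// ler_pdivrMr//; apply/andP; split; lra.
Qed.

Lemma smoothstep_cvg (v : R) : `|v| <= 1 ->
  iter n (@smoothstep R) v @[n --> \oo] --> Num.sg v.
Proof.
wlog v0 : v / 0 <= v => [wl|].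
  have [/wl//|v0] := leP 0 v; rewrite -normrN => v1.
  have := wl (- v); rewrite oppr_ge0 ltW// => /(_ isT v1) h.
  rewrite -[v]opprK sgrN; under eq_fun do rewrite smoothstep_iterN.
  exact: cvgN.
rewrite ger0_norm// => v1; move: v0; rewrite le_eqVlt => /orP[/eqP <-|v0].
  by rewrite sgr0; under eq_fun do rewrite smoothstep_iter0; exact: cvg_cst.
rewrite gtr0_sg//; apply/cvgrPdist_lt => eps eps0.
have q1 : `|1 - v / 2| < 1 by rewrite ger0_norm; lra.
have /cvgrPdist_lt/(_ _ eps0)[N _ HN] := cvg_expr q1.
exists N => // n /HN; rewrite sub0r normrN ger0_norm; last first.
  by rewrite exprn_ge0//; lra.
have [/andP[_ h2] h3] := smoothstep_iter_gt0 n v0 v1.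
by rewrite ger0_norm ?subr_ge0//; exact: le_lt_trans.
Qed.

Lemma normc_real (x : R) : `|x%:C%C| = `|x|%:C%C :> R[i].
Proof. by rewrite normc_def /= expr0n addr0 sqrtr_sqr. Qed.

Lemma cvg_real_complex (u : nat -> R) (l : R) : u n @[n --> \oo] --> l ->
  ((u n)%:C%C : R[i]^o) @[n --> \oo] --> (l%:C%C : R[i]^o).
Proof.
move=> /cvgrPdist_lt ul; apply/cvgrPdist_lt => eps;
  rewrite ltcE /= => /andP[/eqP e0 eps0].
have [N _ HN] := ul _ eps0; exists N => // n /HN h.
by rewrite -rmorphB /= normc_real ltcE /= e0 eqxx.
Qed.

Definition commuting_continuous g := bounded_continuous g /\ commuting g.

Lemma commuting_continuous_comb (c : R[i]) g h : commuting_continuous g ->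
  commuting_continuous h -> commuting_continuous (fun t => c * g t + h t).
Proof.
move=> [bg cg] [bh ch]; have bgh := bounded_continuous_comb c bg bh.
by split => //; apply: commuting_comb => //; apply: borel_continuous; case: bgh.
Qed.

Lemma commuting_continuous_mul g h : commuting_continuous g ->
  commuting_continuous h -> commuting_continuous (fun t => g t * h t).
Proof.
move=> [bg cg] [bh ch]; have bgh := bounded_continuous_mul bg bh.
by split => //; apply: commuting_mul => //; apply: borel_continuous; case: bgh.
Qed.

Lemma commuting_continuous_one : commuting_continuous (fun=> 1).
Proof. by split; [exact: bounded_continuous_cst|exact: commuting_one]. Qed.

Lemma commuting_continuous_zero : commuting_continuous (fun=> 0).
Proof.
have := commuting_continuous_comb (-1) commuting_continuous_one
  commuting_continuous_one.
by under eq_fun do rewrite mulr1 addNr.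
Qed.

Lemma commuting_continuous_smoothstep g : commuting_continuous g ->
  commuting_continuous (fun t => smoothstep (g t)).
Proof.
move=> cg; have c1 := commuting_continuous_one;
  have c0 := commuting_continuous_zero.
have := commuting_continuous_comb 2^-1 (commuting_continuous_mul cg
  (commuting_continuous_comb (-1) (commuting_continuous_mul cg cg)
     (commuting_continuous_comb 3 c1 c0))) c0.
by congr commuting_continuous; apply/funext => t; rewrite /smoothstep; field.
Qed.

Lemma commuting_continuous_affine (c d : R[i]) :
  commuting_continuous (fun t => c * t + d).
Proof.
have c1 := commuting_continuous_one; have c0 := commuting_continuous_zero.
have cid : commuting_continuous id.
  by split; [exact: bounded_continuous_id|exact: commuting_id].
have := commuting_continuous_comb c cid (commuting_continuous_comb d c1 c0).
by congr commuting_continuous; apply/funext => t; rewrite mulr1 addr0.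
Qed.

Lemma commuting_sg_approx (c d : R[i]) n :
  commuting (fun t => iter n (@smoothstep R[i]) (c * t + d)).
Proof.
suff : commuting_continuous (fun t => iter n (@smoothstep R[i]) (c * t + d)).
  by case.
elim: n => [|n IH]; first exact: commuting_continuous_affine.
exact: commuting_continuous_smoothstep IH.
Qed.

Definition halfplane (a : R) : set R[i] := [set t | a < complex.Re t].

Lemma open_halfplane a : open (halfplane a : set R[i]^o).
Proof.
rewrite openE => t /= at_; apply/nbhs_ballP.
exists (complex.Re t - a)%:C%C; first by rewrite /= ltcR subr_gt0.
move=> s /=; rewrite -ball_normE /= => ts.
have := le_lt_trans (normc_ge_Re _) ts; rewrite ltcR => h.
have := le_lt_trans (ler_norm _) h; rewrite raddfB /= /halfplane /=; lra.
Qed.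

Lemma open_Re_lt a : open ([set t | complex.Re t < a] : set R[i]^o).
Proof.
have := @open_halfplane (- a); move: (@opp_continuous R[i]^o) =>
  /continuousP/[apply].
by congr open; apply/seteqP; split=> t; rewrite /halfplane /= raddfN /= ltrN2.
Qed.

Lemma open_Im_lt a : open ([set t | complex.Im t < a] : set R[i]^o).
Proof.
have ic : continuous (fun t : R[i]^o => t * 'i%C : R[i]^o).
  move=> t; apply: (@continuousM _ R[i]^o id (fun=> 'i%C) t).
    by move=> ?; exact.
  exact: cst_continuous.
have := @open_halfplane (- a); move/continuousP: ic => /[apply].
by congr open; apply/seteqP; split=> t; rewrite /halfplane /= ReiNIm ltrN2.
Qed.

Lemma sigma_halfplaneN a : sigma [set t : R[i] | complex.Re t < a].
Proof. by apply: sigma_open; exact: open_Re_lt. Qed.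

Lemma commuting_sg (a : R) : commuting (fun t =>
  (Num.sg (complex.Re t - a))%:C%C).
Proof.
have [m m0 Dm] := spectrum_bounded.
have mE : m = (complex.Re m)%:C%C by rewrite RRe_real// gtr0_real.
(* Division by [l] brings [t - a] into [[-1, 1]] for all [t] in the spectrum. *)
pose l := complex.Re m + `|a| + 1.
have l0 : 0 < l.
  by move: m0; rewrite mE ltcR => h; rewrite ltr_pwDr// addr_ge0// ltW.
pose v (t : R[i]) := (complex.Re t - a) / l.
have v1 t : D t -> `|v t| <= 1.
  move=> /Dm; rewrite mE => /(le_trans (normc_ge_Re _)); rewrite lecR => h.
  rewrite normrM normfV (gtr0_norm l0) ler_pdivrMr// mul1r.
  by rewrite (le_trans (ler_normB _ _))// /l; lra.
have vE n t : D t ->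
    iter n (@smoothstep R[i]) ((l^-1)%:C%C * t + (- a / l)%:C%C) =
    (iter n (@smoothstep R) (v t))%:C%C.
  move=> /spectrum_real t0; have tE : t = (complex.Re t)%:C%C.
    by case: t t0 => x y /= ->.
  elim: n => [|n IH].
    by rewrite /= {1}tE -rmorphM -rmorphD /v /=; congr (_ %:C)%C; field;
      rewrite gt_eqF.
  rewrite !iterS IH /smoothstep.
  by rewrite fmorph_div /= rmorphM rmorphB rmorphXn /= !rmorph_nat.
apply: (commuting_cvg (gn := fun n t =>
    iter n (@smoothstep R[i]) ((l^-1)%:C%C * t + (- a / l)%:C%C)) (M := 1)).
- by move=> n; exact: commuting_sg_approx.
- have s1 : sigma (halfplane a) by apply: sigma_open; exact: open_halfplane.
  have := borel_indic_add 1 s1 (borel_indic_add (-1) (sigma_halfplaneN a)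
    borel_zero).
  congr bounded_borel_on; apply/funext => t; rewrite !indicE addr0 mul1r mulN1r.
  have -> : (t \in halfplane a) = (a < complex.Re t).
    by apply/idP/idP => [/set_mem|h]; last exact: mem_set.
  have -> : (t \in [set t : R[i] | complex.Re t < a]) = (complex.Re t < a).
    by apply/idP/idP => [/set_mem|h]; last exact: mem_set.
  have [h|h|->] := ltgtP (complex.Re t) a.
  - by rewrite add0r ltr0_sg ?subr_lt0// rmorphN.
  - by rewrite subr0 gtr0_sg ?subr_gt0.
  - by rewrite [a - a]subrr sgr0 subrr.
- move=> n t Dt; rewrite vE// normc_def /= expr0n addr0 sqrtr_sqr lecR.
  exact/smoothstep_iter_norm/v1.
- move=> t Dt; under eq_fun do rewrite vE//.
  rewrite -[Num.sg _]mulr1 -(gtr0_sg (_ : 0 < l^-1)) ?invr_gt0// -sgrM.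
  exact/cvg_real_complex/smoothstep_cvg/v1.
Qed.

Lemma commuting_zero : commuting (fun=> 0).
Proof. by case: commuting_continuous_zero. Qed.

Lemma commuting_indic_add (c : R[i]) (S : set R[i]) g : sigma S ->
  commuting \1_S -> commuting g -> commuting (fun t => c * \1_S t + g t).
Proof.
by move=> sS cS cg; apply: commuting_comb => //; apply: borel_indic_add;
  case: cg.
Qed.

(** * Spectral projections of Borel sets *)

Definition commuting_sets : set (set R[i]^o) :=
  [set S | sigma S /\ commuting \1_S].

Lemma commuting_setC S : commuting_sets S -> commuting_sets (~` S).
Proof.
move=> [sS cS]; split; first exact: sigma_setC.
have := commuting_indic_add (-1) sS cS commuting_one.
congr commuting; apply/funext => t; rewrite !indicE in_setC mulN1r /=.
by case: (t \in S); rewrite /= ?addNr// oppr0 add0r.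
Qed.

Lemma commuting_setI S S' : commuting_sets S -> commuting_sets S' ->
  commuting_sets (S `&` S').
Proof.
move=> [sS cS] [sS' cS']; have sI := sigma_setI sS sS'; split => //.
have E : \1_(S `&` S') = (fun t => \1_S t * \1_S' t) :> (R[i] -> R[i]).
  by apply/funext => t; rewrite !indicE in_setI -natrM mulnb.
by rewrite E; apply: commuting_mul => //; rewrite -E; exact: borel_indic.
Qed.

Lemma commuting_setU S S' : commuting_sets S -> commuting_sets S' ->
  commuting_sets (S `|` S').
Proof.
move=> cS cS'; rewrite -[S `|` S']setCK setCU.
by apply: commuting_setC; apply: commuting_setI; exact: commuting_setC.
Qed.

Lemma commuting_set0 : commuting_sets set0.
Proof.
split; first by apply: sigma_open; exact: open0.
by rewrite indic0; exact: commuting_zero.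
Qed.

Lemma commuting_bigcup (F : nat -> set R[i]^o) :
  (forall n, commuting_sets (F n)) -> commuting_sets (\bigcup_n F n).
Proof.
move=> cF; have sU : sigma (\bigcup_n F n).
  by apply: sigma_bigcup => n; case: (cF n).
split => //.
pose G n : set R[i]^o := \big[setU/set0]_(k < n) F k.
have cG n : commuting_sets (G n).
  rewrite /G; elim: n => [|n IH]; first by rewrite big_ord0;
    exact: commuting_set0.
  by rewrite big_ord_recr; exact: commuting_setU.
apply: (commuting_cvg (gn := fun n => \1_(G n)) (M := 1)).
- by move=> n; case: (cG n).
- exact: borel_indic.
- by move=> n t _; rewrite indicE; case: (t \in _); rewrite ?normr1 ?normr0.
- move=> t _; apply: cvg_near_cst.
  have [[k _ Fk]|Ft] := pselect ((\bigcup_n F n) t).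
    exists k.+1 => // n /= kn; rewrite !indicE [in LHS]mem_set; last first.
      by rewrite /G -bigcup_mkord; exists k.
    by rewrite mem_set//; exists k.
  exists 0 => // n /= _; rewrite !indicE !memNset//.
  by move=> Gt; apply: Ft; move: Gt; rewrite /G -bigcup_mkord => -[k _ ?];
    exists k.
Qed.

Lemma commuting_halfplane a : commuting_sets (halfplane a).
Proof.
have sh : sigma (halfplane a) by apply: sigma_open; exact: open_halfplane.
split => //.
have bh := borel_indic sh; have cs := commuting_sg a;
  set s := (fun t => _) in cs.
have inE1 t : (t \in halfplane a) = (a < complex.Re t).
  by apply/idP/idP => [/set_mem|h]; last exact: mem_set.
have inE2 t : (t \in [set t : R[i] | complex.Re t < a]) = (complex.Re t < a).
  by apply/idP/idP => [/set_mem|h]; last exact: mem_set.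
(* The polynomial [s + s^2] sends the values [-1, 0, 1] of the sign to [0, 0, 2]. *)
have sE : (fun t => 1 * s t + s t * s t) = (fun t =>
  2 * \1_(halfplane a) t + 0).
  apply/funext => t; rewrite indicE inE1 /s.
  have [h|h|->] := ltgtP (complex.Re t) a.
  - by rewrite ltr0_sg ?subr_lt0// rmorphN rmorph1 -[nat_of_bool false]/0%N;
      ring.
  - by rewrite gtr0_sg ?subr_gt0// rmorph1 -[nat_of_bool true]/1%N; ring.
  - by rewrite [a - a]subrr sgr0 rmorph0 -[nat_of_bool false]/0%N; ring.
have ssE : (fun t => s t * s t) = (fun t => 1 * \1_(halfplane a) t +
    (1 * \1_[set t : R[i] | complex.Re t < a] t + 0)).
  apply/funext => t; rewrite !indicE inE1 inE2 /s.
  have [h|h|->] := ltgtP (complex.Re t) a.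
  - by rewrite ltr0_sg ?subr_lt0// rmorphN rmorph1
      -[nat_of_bool false]/0%N -[nat_of_bool true]/1%N; ring.
  - by rewrite gtr0_sg ?subr_gt0// rmorph1 -[nat_of_bool false]/0%N
      -[nat_of_bool true]/1%N; ring.
  - by rewrite [a - a]subrr sgr0 rmorph0 -[nat_of_bool false]/0%N; ring.
have css : commuting (fun t => s t * s t).
  apply: commuting_mul => //; rewrite ssE.
  apply: borel_indic_add => //; apply: borel_indic_add borel_zero.
  exact: sigma_halfplaneN.
have cs1 : commuting (fun t => 1 * s t + s t * s t).
  by apply: commuting_comb => //; rewrite sE; apply: borel_indic_add => //;
    exact: borel_zero.
have E : \1_(halfplane a) = (fun t => 2^-1 * (1 * s t + s t * s t) + 0).
  apply/funext => t; rewrite -[1 * s t + _]/((fun t =>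
    1 * s t + s t * s t) t) sE.
  by field.
rewrite E; apply: commuting_comb => //; first exact: commuting_zero.
by rewrite -E.
Qed.

(** The spectrum is real, and on the real line [U] is the countable union of the half-open rational
    intervals that it contains; an interval open on the left and closed on the right is a half-plane
    minus another one. The union agrees with [U] on the spectrum only, which [commuting_ext]
    accepts. *)
Lemma commuting_open (U : set R[i]^o) : open U -> commuting_sets U.
Proof.
move=> Uo; split; first exact: sigma_open.
pose V (p : rat * rat) : set R[i]^o :=
  halfplane (ratr p.1) `&` ~` halfplane (ratr p.2).
pose inU (p : rat * rat) := `[< forall s : R,
  ratr p.1 < s -> s <= ratr p.2 -> U s%:C%C >].
pose W n : set R[i]^o :=
  if unpickle n is Some p then (if inU p then V p else set0) else set0.
have cW : commuting_sets (\bigcup_n W n).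
  apply: commuting_bigcup => n; rewrite /W.
  case: unpickle => [p|]; last exact: commuting_set0.
  case: ifP => _; last exact: commuting_set0.
  by apply: commuting_setI; [|apply: commuting_setC];
    exact: commuting_halfplane.
apply: (@commuting_ext \1_(\bigcup_n W n)); first by case: cW.
  by apply: borel_indic; exact: sigma_open.
move=> t /spectrum_real t0; have tE : t = (complex.Re t)%:C%C.
  by case: t t0 => x y /= ->.
rewrite !indicE; congr (_%:R); congr nat_of_bool; apply/idP/idP.
  move=> /set_mem[n _]; rewrite /W; case: unpickle => // p;
    case: ifP => // /asboolP h.
  rewrite /V /halfplane /= => -[h1 /negP]; rewrite -leNgt => h2.
  by apply/mem_set; rewrite tE; exact: h.
move=> /set_mem Ut; apply/mem_set.
move: Uo; rewrite openE => /(_ _ Ut)/nbhs_ballP[e /= e0 eU].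
have eE : e = (complex.Re e)%:C%C by rewrite RRe_real// gtr0_real.
have {}e0 : 0 < complex.Re e by move: e0; rewrite {1}eE ltcR.
have [p1] : exists q : rat, ratr q \in `](complex.Re t - complex.Re e),
  (complex.Re t)[.
  by apply: rat_in_itvoo; rewrite gtrBl.
have [p2] : exists q : rat, ratr q \in `](complex.Re t),
  (complex.Re t + complex.Re e)[.
  by apply: rat_in_itvoo; rewrite ltrDl.
rewrite !in_itv /= => /andP[h1 h2] /andP[h3 h4].
have [n nE] : exists n, unpickle n = Some (p1, p2).
  by exists (pickle (p1, p2)); rewrite pickleK.
exists n => //; rewrite /W nE.
rewrite ifT; first by split => //=; apply/negP; rewrite -leNgt ltW.
apply/asboolP => s /= s1 s2; apply: eU; rewrite -ball_normE /=.
rewrite tE -rmorphB /= normc_real eE ltcR ltr_norml; apply/andP; split; lra.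
Qed.

Lemma commuting_borel (S : set R[i]^o) : sigma S -> commuting_sets S.
Proof.
apply: smallest_sub; last exact: commuting_open.
split; [exact: commuting_set0| |exact: commuting_bigcup].
by move=> U cU; rewrite setTD; exact: commuting_setC.
Qed.

(** * Approximation by simple functions *)

Lemma commuting_simple (s : seq (R[i] * set R[i])) :
  (forall p, p \in s -> sigma p.2) ->
  commuting (fun t => \sum_(p <- s) p.1 * \1_(p.2) t).
Proof.
elim: s => [|p s IH] hs; first by under eq_fun do rewrite big_nil;
  exact: commuting_zero.
under eq_fun do rewrite big_cons.
have sp : sigma p.2 by apply: hs; rewrite inE eqxx.
apply: commuting_indic_add => //; first by case: (commuting_borel sp).
by apply: IH => p' hp'; apply: hs; rewrite inE hp' orbT.
Qed.

(** The sum is the integer part of [x]. *)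
Lemma sum_threshold (n : nat) (x : R) : 0 <= x -> x <= n%:R ->
  x - 1 <= \sum_(j < n) (j.+1%:R <= x)%R%:R <= x.
Proof.
elim: n => [|n IH] x0 xn.
  by rewrite big_ord0 x0 andbT lerBlDr add0r (le_trans xn)// ler01.
rewrite big_ord_recr /=; have [xn'|xn'] := leP x n%:R.
  rewrite [n.+1%:R <= x]leNgt (le_lt_trans xn') ?ltr_nat//= addr0.
  exact: IH.
have -> : \sum_(i < n) (i.+1%:R <= x)%R%:R = n%:R :> R.
  rewrite (eq_bigr (fun=> 1)) ?sumr_const ?card_ord// => i _.
  by rewrite (le_trans _ (ltW xn'))// ler_nat.
have [h|h] := leP n.+1%:R x.
  by rewrite natr1 h andbT (le_trans _ xn)// gerBl.
by rewrite addr0 (ltW xn') andbT lerBlDr natr1 ltW.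
Qed.

(** The right endpoint of the interval of index [j] when [[-m, m]] is cut into [n.+1] equal ones. *)
Definition level (m : R) (n j : nat) : R := m * 2 / n.+1%:R * j.+1%:R - m.

Lemma level_sum_approx (m v : R) n : 0 < m -> `|v| <= m ->
  `|m * 2 / n.+1%:R * (\sum_(j < n.+1) (level m n j <= v)%R%:R) - m - v|
    <= m * 2 / n.+1%:R.
Proof.
move=> m0; rewrite ler_norml => /andP[v1 v2].
have n0 : 0 < n.+1%:R :> R by rewrite ltr0n.
pose d := m * 2 / n.+1%:R.
have d0 : 0 < d by rewrite divr_gt0// mulr_gt0.
have dn : d * n.+1%:R = m * 2 by rewrite divfK// gt_eqF.
pose x := (v + m) / d.
have dx : d * x = v + m by rewrite mulrC divfK// gt_eqF.
have x0 : 0 <= x by rewrite divr_ge0 ?(ltW d0)//; lra.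
have xn : x <= n.+1%:R by rewrite ler_pdivrMr// mulrC dn; lra.
rewrite (eq_bigr (fun j : 'I_n.+1 => (j.+1%:R <= x)%R%:R)); last first.
  move=> j _; congr (nat_of_bool _)%:R; rewrite /level -/d lerBlDr -dx.
  by rewrite ler_pM2l.
have /andP[h1 h2] := sum_threshold x0 xn.
set s := \sum_(j < _) _ in h1 h2 *; rewrite -/d.
have h3 : d * s <= d * x by rewrite ler_pM2l.
have h4 : d * (x - 1) <= d * s by rewrite ler_pM2l.
rewrite ler_norml; apply/andP; split; lra.
Qed.

Lemma commuting_bounded_borel f : bounded_borel_on D f -> commuting f.
Proof.
move=> bf; have [[M fM] f_sigma] := bf.
(* The sign of [M] is only known once the spectrum has a point; [m] is positive in any case. *)
pose m := complex.Re `|M| + 1.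
have MR : `|M| = (complex.Re `|M|)%:C%C by rewrite RRe_real// normr_real.
have m0 : 0 < m by rewrite ltr_wpDl// -ler0c -MR.
have fm t : D t -> `|f t| <= m%:C%C.
  move=> Dt; have M0 := le_trans (normr_ge0 _) (fM t Dt).
  by rewrite (le_trans (fM t Dt))// -(ger0_norm M0) MR lecR lerDl.
have Rem t : D t -> `|complex.Re (f t)| <= m.
  by move=> /fm h; rewrite -lecR (le_trans (normc_ge_Re _)).
have Imm t : D t -> `|complex.Im (f t)| <= m.
  move=> /fm h; rewrite -lecR -normrN -ReiNIm (le_trans (normc_ge_Re _))//
    normrM.
  by rewrite [X in _ * X]normc_def /= expr0n expr1n add0r sqrtr1 mulr1.
pose d n := m * 2 / n.+1%:R.
have d0 n : 0 < d n by rewrite divr_gt0 ?ltr0n// mulr_gt0.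
(* Measurability of [f] concerns preimages of open sets, so the set where [h (f t)] reaches the
   level is taken as a complement. *)
pose S (h : R[i] -> R) n j : set R[i]^o := D `\` (f @^-1` [set u | h u < level
  m n j]).
have sigma_S h n j : (forall l, open ([set u | h u < l] : set R[i]^o)) ->
    sigma (S h n j).
  move=> ho; have -> : S h n j = D `&` ~` (D `&` f @^-1` [set u | h u < level m
    n j]).
    apply/seteqP; split=> t /= [Dt h1]; split => //; first by case.
    by move=> h2; apply: h1.
  by apply: sigma_setI => //; apply: sigma_setC; exact: f_sigma.
pose sq (c : R[i]) h n : seq (R[i] * set R[i]) :=
  [seq (c * (d n)%:C%C, S h n j) | j <- index_iota 0 n.+1].
(* The last entry, on the whole plane, is the offset [-m] of both staircases. *)
pose s n := sq 1 (@complex.Re R) n ++ sq 'i%C (@complex.Im R) n ++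
  [:: ((- m)%:C%C + 'i%C * (- m)%:C%C, setT : set R[i])].
pose Ap (h : R[i] -> R) n t :=
  d n * (\sum_(j < n.+1) (level m n j <= h (f t))%R%:R) - m.
have sqE c h n t : D t -> \sum_(p <- sq c h n) p.1 * \1_(p.2) t =
    c * (Ap h n t)%:C%C + c * m%:C%C.
  move=> Dt; rewrite big_map big_mkord /= -mulrDr -rmorphD /Ap subrK [in
    RHS]rmorphM /=.
  rewrite [RHS]mulrA rmorph_sum /= mulr_sumr; apply: eq_bigr => j _;
    congr (_ * _).
  rewrite indicE rmorph_nat; congr (nat_of_bool _)%:R.
  apply/idP/idP => [/set_mem[_] /negP /=|h1]; first by rewrite -leNgt.
  by apply/mem_set; split => //=; apply/negP; rewrite -leNgt.
have fnE n t : D t -> \sum_(p <- s n) p.1 * \1_(p.2) t =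
    (Ap (@complex.Re R) n t)%:C%C + 'i%C * (Ap (@complex.Im R) n t)%:C%C.
  move=> Dt; rewrite !big_cat /= big_seq1 !sqE// indicE in_setT.
  by rewrite !rmorphN /= mulr1; ring.
have close n t : D t -> `|\sum_(p <- s n) p.1 * \1_(p.2) t - f t| <= (2 * d
  n)%:C%C.
  move=> Dt; rewrite fnE// [f t]complexE opprD addrACA -rmorphB -mulrBr
    -rmorphB.
  rewrite (le_trans (ler_normD _ _))// normrM !normc_real [`|'i%C|]normc_def /=.
  rewrite expr0n expr1n add0r sqrtr1 mul1r -rmorphD /= lecR mulrDl mul1r.
  by apply: lerD; apply: level_sum_approx => //; [exact: Rem|exact: Imm].
(* The bound [5 * m] is [m] for [f] plus the error [2 * d n], which is at most [4 * m]. *)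
apply: (commuting_cvg (gn := fun n t => \sum_(p <- s n) p.1 * \1_(p.2) t)
    (M := (5 * m)%:C%C)) => //.
- move=> n; apply: commuting_simple => p; rewrite !mem_cat => /or3P[||].
  + by move=> /mapP[j _ ->]; apply: sigma_S => l; exact: open_Re_lt.
  + by move=> /mapP[j _ ->]; apply: sigma_S => l; exact: open_Im_lt.
  + by rewrite inE => /eqP ->; apply: sigma_open; exact: openT.
- move=> n t Dt; rewrite -(subrK (f t) (\sum_(p <- _) _)) (le_trans (ler_normD
    _ _))//.
  rewrite (le_trans (lerD (close n t Dt) (fm t Dt)))// -rmorphD lecR.
  have : d n <= m * 2 by rewrite ler_pdivrMr ?ltr0n// ler_peMr ?ler1n//
    mulr_ge0 ?ltW.
  lra.
- move=> t Dt; apply/cvgrPdist_lt => eps;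
    rewrite ltcE /= => /andP[/eqP e0 eps0].
  have e1 : 0 < complex.Re eps / (4 * m) by rewrite divr_gt0// mulr_gt0.
  have := near_infty_natSinv_lt (PosNum e1); apply: filterS => n /= hn.
  rewrite distrC (le_lt_trans (close n t Dt))// ltcE /= e0 eqxx /=.
  move: hn; rewrite ltr_pdivlMr ?mulr_gt0// /d => hn.
  by rewrite (le_lt_trans _ hn)// le_eqVlt; apply/orP; left; apply/eqP; ring.
Qed.

End BorelCalculus.

(** * Uniqueness of inverses and the final assembly *)

Lemma op_invE (R : realType) (H : completeNormedModType R[i]) (T N : H -> H) :
  inverse_of T N -> op_inv T = N.
Proof.
move=> [TN NT]; rewrite /op_inv;
  case: xgetP => [N' _ [_ N'T]|/(_ N)/(_ (conj TN NT))//].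
apply/funext => x; have Tx : T (N x) = x by exact: (congr1 (@^~ x) TN).
by rewrite -{1}Tx; exact: (congr1 (@^~ (N x)) N'T).
Qed.

Lemma inverse_of_inj (R : realType) (H : completeNormedModType R[i])
  (T T' N : H -> H) : inverse_of T N -> inverse_of T' N -> T = T'.
Proof.
move=> [TN _] [_ NT']; apply/funext => x.
have {1}<- : N (T' x) = x by exact: (congr1 (@^~ x) NT').
exact: (congr1 (@^~ (T' x)) TN).
Qed.

Lemma borel_calculus_in_vn (R : realType) (H : completeNormedModType R[i])
    (dot : {dot H for Num.conj}) (A B : set (H -> H)) (X : H -> H)
    (Phi : (R[i] -> R[i]) -> (H -> H)) (f : R[i] -> R[i]) :
  hilbert_dot dot -> von_neumann_algebra dot A -> von_neumann_algebra dot B ->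
  A X -> B X -> self_adjoint dot X ->
  borel_functional_calculus dot A X Phi -> bounded_borel_on (spectrum A X) f ->
  B (Phi f).
Proof.
move=> hdot hA hB AX BX Xsa hPhi hf; have [_ _ <-] := hB.
split; first exact: (fc_bounded hPhi hf).
move=> T [Tb Tc]; apply/esym.
(* That the spectrum is Borel is read off from [hf], with the whole plane as open set. *)
have sD : <<s @open R[i]^o >> (spectrum A X).
  by have [_ /(_ setT openT)] := hf; rewrite preimage_setT setIT.
by have [_] := commuting_bounded_borel hdot hA AX Xsa sD hPhi Tb (Tc X BX) hf.
Qed.

Theorem theorem1p3 (R : realType) (H : completeNormedModType R[i])
    (dot : {dot H for Num.conj}) (hdot : hilbert_dot dot)
    (A B : set (H -> H)) (phi : (H -> H) -> R[i]) (E : (H -> H) -> (H -> H))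
    (hA : von_neumann_algebra dot A)
    (hphi : faithful_normal_tracial_state dot A phi)
    (hB : von_neumann_algebra dot B) (hBA : B `<=` A)
    (hE : conditional_expectation dot A B phi E)
    (X Y : H -> H) (hXA : A X) (hYA : A Y)
    (hXsa : self_adjoint dot X) (hYsa : self_adjoint dot Y)
    (hXB : B X) (hYB : free_from phi Y B)
    (Phi : (R[i] -> R[i]) -> (H -> H))
    (hPhi : borel_functional_calculus dot A X Phi)
    (f : R[i] -> R[i]) (hf : bounded_borel_on (spectrum A X) f)
    (hfX : Phi f <> 0) :
  exists! delta : upper_half_plane R -> R[i],
    forall z : upper_half_plane R,
      let fX := Phi f in
      let fXs := adjoint dot (Phi f) in
      let D := val z *: (id : H -> H) - X - delta z *: (fX \o fXs) in
      invertible_in A D /\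
      E (op_inv (val z *: (id : H -> H) - X - (fX \o Y \o fXs))) = op_inv D.
Proof.
have FB := borel_calculus_in_vn hdot hA hB hXA hXB hXsa hPhi hf.
have [FsB adjF] := vn_adjoint hB FB.
set F := Phi f in FB FsB adjF hfX *; set Fs := adjoint dot F in FsB adjF *.
pose M (z : upper_half_plane R) := val z *: (id : H -> H) - X - (F \o Y \o Fs).
pose D (z : upper_half_plane R) c := val z *: (id : H -> H) - X - c *: (F \o
  Fs).
have main (z : upper_half_plane R) : exists c, A (E (op_inv (M z))) /\
    inverse_of (D z c) (E (op_inv (M z))).
  have [N [c [AN MN DN]]] := operator_subordination hdot hA hphi hB hBA hE hYA
    hYB
    hXB hXsa hYsa FB adjF hfX (valP z).
  have MzN : inverse_of (M z) N by rewrite /M -addrA -opprD.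
  exists c; rewrite (op_invE MzN); split => //.
  exact: (hBA _ (condexp_range hE AN)).
have [delta hdelta] := choice main.
exists delta; split => [z /=|delta' hdelta'].
  have [AG DG] := hdelta z; split; first by exists (E (op_inv (M z))).
  by rewrite (op_invE DG).
apply/funext => z; have [AG DG] := hdelta z.
have [[N AN D'N] EN] := hdelta' z.
(* One operator is now inverse to both [D z (delta z)] and [D z (delta' z)], so these coincide, and
   the two scalars can differ only if [F \o Fs = 0]. *)
rewrite -/(M z) (op_invE D'N) in EN; rewrite EN in DG.
have /addrI/oppr_inj/eqP := inverse_of_inj DG D'N.
rewrite -subr_eq0 -scalerBl scaler_eq0 subr_eq0 => /orP[/eqP//|/eqP FFs0].
(* The adjoint of [Fs] is [F], so faithfulness applied to [Fs] excludes [F \o Fs = 0]. *)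
exfalso; apply: hfX; have Fs0 : Fs = 0.
  apply: (state_faithful hphi); first exact: hBA.
  rewrite (adjointE (is_adjoint_sym adjF)) FFs0.
  have := state_linear hphi (-1) (vn_0 hA) (vn_0 hA).
  by rewrite scaler0 addr0 mulN1r addNr.
apply: (is_adjoint_uniq (T := Fs)); first exact: is_adjoint_sym.
by rewrite Fs0 => x y; rewrite linear0l linear0r.
Qed.
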